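(* The set of all semigroup varieties of finite degree is definable. For every natural number $k$, the set of all semigroup varieties of degree $k$ is definable.
   Context: $\mathbf{SEM}$ denotes the lattice of all semigroup varieties, ordered by inclusion, with join $\vee$ and meet $\wedge$. A subset $A$ of a lattice $\langle L;\vee,\wedge\rangle$ is called definable in $L$ if there is a first-order formula $\Phi(x)$ with one free variable $x$ (and no parameters) in the language of the lattice operations $\vee$ and $\wedge$ such that, for every $a\in L$, the sentence $\Phi(a)$ is true in $L$ if and only if $a\in A$. A set of semigroup varieties is called definable if it is definable in $\mathbf{SEM}$. Natural numbers start from $1$. A semigroup variety $\mathcal V$ is called a variety of finite degree if all nilsemigroups in $\mathcal V$ are nilpotent. It is called a variety of degree $k$ if the nilpotency degrees of nilsemigroups in $\mathcal V$ are bounded by the number $k$ and $k$ is the least number with this property. (A nilsemigroup is a semigroup with zero in which every element has a power equal to zero; a semigroup $S$ with zero is nilpotent if $S^k=\{0\}$ for some $k$, and the least such $k$ is its nilpotency degree.) *)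

(* Defs.v *)
From HB Require Import structures.
From mathcomp Require Import all_boot all_order.
From mathcomp Require Import boolp classical_sets.

Set Implicit Arguments.
Unset Strict Implicit.
Unset Printing Implicit Defensive.

Import Order.TTheory.
Local Open Scope classical_set_scope.

(** * First-order formulas in the language of lattices *)

(* Variables are de Bruijn indices: [Var 0] is the variable bound by the
   innermost quantifier. *)
Inductive term :=
  | Var of nat
  | Join of term & term
  | Meet of term & term.

Inductive formula :=
  | Eq of term & term
  | Not of formula
  | And of formula & formula
  | Or of formula & formula
  | Implies of formula & formula
  | Forall of formula
  | Exists of formula.

Fixpoint term_closed (n : nat) (t : term) : bool :=
  match t with
  | Var i => i < n
  | Join t1 t2 | Meet t1 t2 => term_closed n t1 && term_closed n t2
  end.

(* The free variables of the formula have index smaller than [n]. *)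
Fixpoint formula_closed (n : nat) (phi : formula) : bool :=
  match phi with
  | Eq t1 t2 => term_closed n t1 && term_closed n t2
  | Not phi1 => formula_closed n phi1
  | And phi1 phi2 | Or phi1 phi2 | Implies phi1 phi2 =>
      formula_closed n phi1 && formula_closed n phi2
  | Forall phi1 | Exists phi1 => formula_closed n.+1 phi1
  end.

Section Satisfaction.
Context {d : Order.disp_t} {L : latticeType d}.

Fixpoint term_val (e : nat -> L) (t : term) : L :=
  match t with
  | Var i => e i
  | Join t1 t2 => Order.join (term_val e t1) (term_val e t2)
  | Meet t1 t2 => Order.meet (term_val e t1) (term_val e t2)
  end.

Definition env_cons (a : L) (e : nat -> L) : nat -> L :=
  fun i => if i is j.+1 then e j else a.

Fixpoint holds (e : nat -> L) (phi : formula) : Prop :=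
  match phi with
  | Eq t1 t2 => term_val e t1 = term_val e t2
  | Not phi1 => ~ holds e phi1
  | And phi1 phi2 => holds e phi1 /\ holds e phi2
  | Or phi1 phi2 => holds e phi1 \/ holds e phi2
  | Implies phi1 phi2 => holds e phi1 -> holds e phi2
  | Forall phi1 => forall a, holds (env_cons a e) phi1
  | Exists phi1 => exists a, holds (env_cons a e) phi1
  end.

(* [Var 0] is the only variable that may be free in [phi], so the values of the
   environment at positive indices are irrelevant. *)
Definition definable (A : set L) : Prop :=
  exists2 phi : formula, formula_closed 1 phi &
    forall a : L, holds (fun=> a) phi <-> A a.

End Satisfaction.

(** * Semigroup varieties *)

(* MathComp's [semigroupType] cannot be used here: the type of all
   [semigroupType]s is too large for classes of them to form an [eqType], hence
   a [latticeType], whereas the universe of [sg_carrier] can be taken smaller. *)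
Record semigroup := Semigroup {
  sg_carrier :> Type;
  sg_mul : sg_carrier -> sg_carrier -> sg_carrier;
  sg_mulA : associative sg_mul;
  sg_inhabited : inhabited sg_carrier
}.

Local Notation "x * y" := (sg_mul x y).

(* [(i, [:: j; ...; k])] is the nonempty word x_i x_j ... x_k over a countable
   alphabet. *)
Definition word : Type := nat * seq nat.

Definition word_val (S : semigroup) (f : nat -> S) (w : word) : S :=
  foldl (fun x i => x * f i) (f w.1) w.2.

Definition identity : Type := word * word.

Definition satisfies (S : semigroup) (u : identity) : Prop :=
  forall f : nat -> S, word_val f u.1 = word_val f u.2.

Definition models (Sigma : set identity) : set semigroup :=
  [set S | forall u, Sigma u -> satisfies S u].

Definition theory (K : set semigroup) : set identity :=
  [set u | forall S, K S -> satisfies S u].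

Record variety := Variety {
  variety_class :> set semigroup;
  variety_equational : exists Sigma, variety_class = models Sigma
}.

Lemma variety_inj (V W : variety) : V = W :> set semigroup -> V = W.
Proof.
case: V W => [K hK] [K' hK'] /= eqK; case: _ / eqK hK' => hK'.
by rewrite (Prop_irrelevance hK hK').
Qed.

Lemma models_theory (V : variety) : models (theory V) = V.
Proof.
have [Sigma VE] := variety_equational V; apply/seteqP; split=> S HS.
  by rewrite VE => u Su; apply: HS => T; rewrite VE; apply.
by move=> u; apply.
Qed.

(** ** The lattice SEM of semigroup varieties *)

HB.instance Definition _ := gen_eqMixin variety.
HB.instance Definition _ := gen_choiceMixin variety.

Definition variety_le (V W : variety) : bool := `[< V `<=` W >].

Fact variety_le_refl : reflexive variety_le.
Proof. by move=> V; apply/asboolP. Qed.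

Fact variety_le_anti : antisymmetric variety_le.
Proof.
by move=> V W /andP[/asboolP VW /asboolP WV]; apply/variety_inj/seteqP.
Qed.

Fact variety_le_trans : transitive variety_le.
Proof.
by move=> V U W /asboolP UV /asboolP VW; apply/asboolP/(subset_trans UV VW).
Qed.

Fact variety_meet_equational (V W : variety) :
  exists Sigma, V `&` W = models Sigma.
Proof.
exists (theory V `|` theory W); rewrite -{1}(models_theory V).
rewrite -{1}(models_theory W); apply/seteqP; split=> S /=.
  by move=> [VS WS] u [/VS|/WS].
by move=> VWS; split=> u Hu; apply: VWS; [left|right].
Qed.

Definition variety_meet (V W : variety) : variety :=
  Variety (variety_meet_equational V W).

Definition variety_join (V W : variety) : variety :=
  Variety (ex_intro _ (theory V `&` theory W) erefl).

Fact SEM_display : Order.disp_t.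
Proof. exact: Order.Disp tt tt. Qed.

HB.instance Definition _ := Order.Le_isPOrder.Build SEM_display variety
  variety_le_refl variety_le_anti variety_le_trans.

Fact variety_meetP (U V W : variety) :
  (U <= variety_meet V W)%O = (U <= V)%O && (U <= W)%O.
Proof.
apply/asboolP/andP => [/= UVW|[/asboolP UV /asboolP UW] S US].
  by split; apply/asboolP => S /UVW [].
by split; [apply: UV|apply: UW].
Qed.

Fact variety_joinP (U V W : variety) :
  (variety_join U V <= W)%O = (U <= W)%O && (V <= W)%O.
Proof.
apply/asboolP/andP => [/= UVW|[/asboolP UW /asboolP VW] S /= US].
  by split; apply/asboolP => S HS; apply: UVW => u [Uu Vu]; [exact: Uu|exact: Vu].
rewrite -(models_theory W) => u Wu; apply: US.
by split=> T HT; apply: Wu; [apply: UW|apply: VW].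
Qed.

HB.instance Definition _ := Order.POrder_MeetJoin_isLattice.Build
  SEM_display variety variety_meetP variety_joinP.

(** * Varieties of finite degree *)

Definition is_zero (S : semigroup) (z : S) : Prop :=
  forall x : S, z * x = z /\ x * z = z.

Definition nilsemigroup (S : semigroup) : Prop :=
  exists2 z : S, is_zero z &
    forall x : S, exists2 n, 0 < n & iterop n (@sg_mul S) x x = z.

(* The set S^k of products of k elements of S; meaningful for 0 < k only. *)
Definition semigroup_power (S : semigroup) (k : nat) : set S :=
  iter k.-1 (fun A : set S => [set a * b | a in A & b in [set: S]]) [set: S].
Arguments semigroup_power : clear implicits.

Definition nilpotent_with (S : semigroup) (k : nat) : Prop :=
  0 < k /\ exists2 z : S, is_zero z & semigroup_power S k = [set z].

Definition nilpotent_semigroup (S : semigroup) : Prop :=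
  exists k, nilpotent_with S k.

Definition is_least (P : nat -> Prop) (k : nat) : Prop :=
  P k /\ forall j, P j -> k <= j.

Definition nilpotency_degree (S : semigroup) (k : nat) : Prop :=
  is_least (nilpotent_with S) k.

Definition finite_degree (V : variety) : Prop :=
  forall S : semigroup, variety_class V S -> nilsemigroup S ->
    nilpotent_semigroup S.

Definition degree_bounded (V : variety) (k : nat) : Prop :=
  forall S : semigroup, variety_class V S -> nilsemigroup S ->
    exists2 j, nilpotency_degree S j & j <= k.

Definition has_degree (V : variety) (k : nat) : Prop :=
  is_least (degree_bounded V) k.

(* Main.v *)
Require Import Defs.
From mathcomp Require Import all_boot all_order.
From mathcomp Require Import zify.
From mathcomp Require Import boolp classical_sets.

Set Implicit Arguments.
Unset Strict Implicit.
Unset Printing Implicit Defensive.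

Import Order.TTheory.
Local Open Scope classical_set_scope.

(** Everything rests on the variety F of commutative semigroups in which every
square is zero ([linear_limit]) and on its subvarieties F_k satisfying moreover
x_1 ... x_k = 0 ([linear_variety k]).  Two words have the same value throughout
F iff they differ by a permutation of letters or both contain a repeated
letter.  Hence an identity that fails in F_(k+1) has a side u that is linear,
i.e. without repeated letters, of length at most k, and its other side is not a
permutation of u.  The main combinatorial fact, [nil_power_zero], is that such
an identity forces S^n = 0 in every nil semigroup S satisfying it, where n is
the length of u.  Since the free semigroup of F is nil but not nilpotent,
and that of F_k is nilpotent of degree k, this gives [finite_degreeP] and
[degree_boundedP]: a variety V has finite degree iff F is not contained in V,
and has degree at most k, for 0 < k, iff F_(k+1) is not contained in V.  The
same fact shows that the proper subvarieties of F are exactly the F_k, so that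
they form a strictly increasing chain F_1 < F_2 < ... below F, with F_1 the
trivial variety and F_2 the variety of null semigroups.

It remains to define F in the lattice.  F is the least variety x satisfying the
first-order property [null_limit x]: x has no maximal proper subvariety, and the
nontrivial subvarieties of x have a least element a, which is moreover a
distributive element of the lattice.

F itself has this property, with a = F_2: the null semigroups form a
distributive element ([null_distributive]).  Conversely let U have the
property.  No nontrivial subvariety of the variety of left zero bands, of right
zero bands or of the variety generated by a cyclic group is distributive, as is
seen by playing off against each other two varieties of nilpotent semigroups,
one satisfying xyxx = yxxy and the other xxyx = yxxy.  Hence U contains none of
these varieties.  If U contained all semilattices, then a would be the variety
of semilattices and U would contain no nontrivial null semigroups, so U would
consist of semilattices and have a coatom.  A variety containing none of these
four kinds of semigroups is nil ([nil_of_no_small_varieties]).  If F were not contained in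
U, then U would be nilpotent; but a nilpotent variety has, up to renaming of
letters, only finitely many identities to distinguish its subvarieties, hence
has a coatom unless it is trivial.

Once F is definable, V has finite degree iff V contains no x with [null_limit x].
V has degree k iff k - 1 is the length of the longest strict chain descending
from V /\ F, because the varieties contained in F form the chain above. *)

Local Infix "**" := sg_mul (at level 40, left associativity).

(** * Words and fully invariant congruences *)

Definition letters (w : word) : seq nat := w.1 :: w.2.

Definition word_mul (u v : word) : word := (u.1, u.2 ++ letters v).

Lemma word_mulA : associative word_mul.
Proof. by case=> i s [j t] [k r]; rewrite /word_mul /letters /= -catA. Qed.

Definition free_semigroup : semigroup :=
  @Defs.Semigroup word word_mul word_mulA (inhabits (0, [::])).

(** Substitution is evaluation in the free semigroup, so that its laws are
    instances of those of [word_val]. *)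
Definition subst (sigma : nat -> word) (w : word) : word :=
  @word_val free_semigroup sigma w.

Lemma letters_mul u v : letters (word_mul u v) = letters u ++ letters v.
Proof. by []. Qed.

Lemma letters_inj : injective letters.
Proof. by case=> i s [j t] [-> ->]. Qed.

Definition morphism (S T : semigroup) (h : S -> T) : Prop :=
  forall x y, h (x ** y) = h x ** h y.

Section RightAction.
Variables (S : semigroup) (f : nat -> S).

(** The right action of a possibly empty list of letters; it makes up for the
    absence of an empty word. *)
Definition word_act (a : S) (s : seq nat) : S := foldl (fun x i => x ** f i) a s.

Lemma word_act_cat a s t : word_act a (s ++ t) = word_act (word_act a s) t.
Proof. exact: foldl_cat. Qed.

Lemma word_act_mul a b s : word_act (a ** b) s = a ** word_act b s.
Proof. by elim: s b => //= i s IHs b; rewrite -sg_mulA IHs. Qed.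

Lemma word_val_act w : word_val f w = word_act (f w.1) w.2.
Proof. by []. Qed.

Lemma word_act_letters a w : word_act a (letters w) = a ** word_val f w.
Proof. by rewrite /= word_act_mul. Qed.

Lemma word_val_mul u v : word_val f (word_mul u v) = word_val f u ** word_val f v.
Proof. by rewrite !word_val_act /= word_act_cat (word_act_letters _ v). Qed.

End RightAction.

Lemma morphism_word_val (S T : semigroup) (h : S -> T) (f : nat -> S) w :
  morphism h -> h (word_val f w) = word_val (h \o f) w.
Proof.
move=> hM; case: w => i s; rewrite !word_val_act /=.
by elim/last_ind: s => [|s j IHs] //; rewrite -cats1 !word_act_cat /= hM IHs.
Qed.

Lemma word_val_subst (S : semigroup) (f : nat -> S) sigma w :
  word_val f (subst sigma w) = word_val (fun i => word_val f (sigma i)) w.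
Proof.
rewrite /subst (@morphism_word_val free_semigroup S (word_val f)) //.
exact: word_val_mul.
Qed.

Lemma eq_in_word_act (S : semigroup) (f g : nat -> S) a s :
  {in s, f =1 g} -> word_act f a s = word_act g a s.
Proof.
elim: s a => //= i s IHs a fg.
by rewrite fg ?mem_head // IHs // => j sj; apply: fg; rewrite in_cons sj orbT.
Qed.

Lemma eq_in_word_val (S : semigroup) (f g : nat -> S) w :
  {in letters w, f =1 g} -> word_val f w = word_val g w.
Proof.
move=> fg; rewrite !word_val_act fg ?mem_head //.
by apply: eq_in_word_act => j wj; apply: fg; rewrite in_cons wj orbT.
Qed.

Lemma subst_mul sigma u v :
  subst sigma (word_mul u v) = word_mul (subst sigma u) (subst sigma v).
Proof. exact: (@word_val_mul free_semigroup). Qed.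

Lemma subst_subst sigma tau w :
  subst tau (subst sigma w) = subst (fun i => subst tau (sigma i)) w.
Proof. exact: (@word_val_subst free_semigroup). Qed.

Lemma letters_subst sigma w :
  letters (subst sigma w) = flatten [seq letters (sigma i) | i <- letters w].
Proof.
case: w => i s; rewrite /subst word_val_act /=.
elim/last_ind: s => [|s j IHs]; first by rewrite /= cats0.
rewrite -cats1 word_act_cat letters_mul IHs map_cat flatten_cat /= cats0.
by rewrite catA.
Qed.

Definition rename (r : nat -> nat) (w : word) : word := (r w.1, map r w.2).

Lemma letters_rename r w : letters (rename r w) = map r (letters w).
Proof. by []. Qed.

Lemma rename_subst r w : rename r w = subst (fun i => (r i, [::])) w.
Proof.
apply: letters_inj; rewrite letters_subst letters_rename.
by elim: (letters w) => //= i s ->.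
Qed.

Record fully_invariant (E : set identity) : Prop := FullyInvariant {
  fi_refl : forall u, E (u, u);
  fi_sym : forall u v, E (u, v) -> E (v, u);
  fi_trans : forall v u w, E (u, v) -> E (v, w) -> E (u, w);
  fi_mul : forall u v u' v', E (u, v) -> E (u', v') ->
    E (word_mul u u', word_mul v v');
  fi_subst : forall sigma u v, E (u, v) -> E (subst sigma u, subst sigma v)
}.

Lemma theory_fully_invariant (K : set semigroup) : fully_invariant (theory K).
Proof.
split=> [u S KS f //|u v uv S KS f|v u w uv vw S KS f|u v u' v' uv uv' S KS f|].
- by symmetry; exact: uv.
- by rewrite (uv S KS f) (vw S KS f).
- by rewrite /= !word_val_mul (uv S KS f) (uv' S KS f).
- by move=> sigma u v uv S KS f; rewrite /= !word_val_subst; apply: uv.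
Qed.

Section RelativelyFree.
Variables (E : set identity) (fiE : fully_invariant E).

(** The quotient of the free semigroup by E is carried by chosen representatives
    of the classes. *)
Definition canon (w : word) : word := xget (0, [::]) [set v | E (w, v)].

Lemma canonP w : E (w, canon w).
Proof. by rewrite /canon; case: xgetP => [v _|/(_ w)]//; case; apply: fi_refl. Qed.

Lemma canon_eq u v : canon u = canon v <-> E (u, v).
Proof.
split=> [uv|uv].
  apply: (fi_trans fiE (canonP u)); rewrite uv; exact: (fi_sym fiE (canonP v)).
rewrite /canon; congr xget; apply/seteqP; split=> w /= H.
  exact: fi_trans fiE _ _ _ (fi_sym fiE uv) H.
exact: fi_trans fiE _ _ _ uv H.
Qed.

Lemma canon_id w : canon (canon w) = canon w.
Proof. by apply/canon_eq/(fi_sym fiE)/canonP. Qed.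

Definition free_carrier := {w : word | canon w == w}.

Definition free_pi (w : word) : free_carrier :=
  exist _ (canon w) (introT eqP (canon_id w)).

Lemma free_pi_eq u v : free_pi u = free_pi v <-> E (u, v).
Proof.
rewrite -canon_eq; split=> [/(congr1 val)//|uv]; exact: val_inj.
Qed.

Lemma free_pi_val x : free_pi (val x) = x.
Proof. by apply: val_inj => /=; apply/eqP/(valP x). Qed.

Definition free_mul (x y : free_carrier) := free_pi (word_mul (val x) (val y)).

Lemma free_mulE u v : free_mul (free_pi u) (free_pi v) = free_pi (word_mul u v).
Proof.
by apply/free_pi_eq; apply: fi_mul => //; apply: fi_sym => //; apply: canonP.
Qed.

Lemma free_mulA : associative free_mul.
Proof.
move=> x y z; rewrite -(free_pi_val x) -(free_pi_val y) -(free_pi_val z).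
by rewrite !free_mulE word_mulA.
Qed.

Definition rel_free : semigroup :=
  @Defs.Semigroup _ free_mul free_mulA (inhabits (free_pi (0, [::]))).

Lemma rel_free_val (sigma : nat -> word) w :
  @word_val rel_free (fun i => free_pi (sigma i)) w = free_pi (subst sigma w).
Proof.
symmetry; apply: (@morphism_word_val free_semigroup rel_free free_pi).
by move=> u v; symmetry; apply: free_mulE.
Qed.

Lemma rel_free_models : models E rel_free.
Proof.
case=> u v uv f.
have -> : f = (fun i => free_pi (val (f i))).
  by apply/funext => i; rewrite free_pi_val.
by rewrite /= !rel_free_val; apply/free_pi_eq; apply: fi_subst.
Qed.

Lemma rel_free_letters w : @word_val rel_free (fun i => free_pi (i, [::])) w = free_pi w.
Proof.
rewrite rel_free_val -(rename_subst id); congr free_pi.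
by apply: letters_inj; rewrite letters_rename map_id.
Qed.

(** Completeness of equational logic: the semigroup [rel_free] satisfies E, and an
    identity outside E fails there when the letters take their own classes as
    values. *)
Lemma theory_models : theory (models E) = E.
Proof.
apply/seteqP; split=> [[u v] uv|u Eu S]; last exact.
have := uv _ rel_free_models (fun i => free_pi (i, [::])).
by rewrite /= !rel_free_letters => /free_pi_eq.
Qed.

End RelativelyFree.

Definition defined_by (E : set identity) : variety := Variety (ex_intro _ E erefl).

Lemma le_theory (V W : variety) : (V <= W)%O <-> theory W `<=` theory V.
Proof.
split=> [/asboolP VW u Wu S VS|WV]; first exact: Wu (VW _ VS).
apply/asboolP => S VS; rewrite -(models_theory W) => u /WV Vu; exact: Vu.
Qed.

Lemma le_defined_by (V : variety) E : (V <= defined_by E)%O <-> E `<=` theory V.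
Proof.
split=> [/asboolP VE u Eu S /VE|EV]; first exact.
by apply/asboolP => S VS u /EV; apply.
Qed.

Lemma defined_by_le E (V : variety) : fully_invariant E ->
  (defined_by E <= V)%O <-> theory V `<=` E.
Proof. by move=> fiE; rewrite le_theory /= theory_models. Qed.

Lemma not_defined_by_le E (V : variety) : fully_invariant E ->
  ~ (defined_by E <= V)%O ->
  exists u v, theory V (u, v) /\ ~ E (u, v).
Proof.
move=> fiE; apply: contra_notP => H; apply/defined_by_le => // -[u v] Vuv.
by apply: contrapT => Euv; apply: H; exists u, v.
Qed.

Lemma theory_join (V W : variety) :
  theory (Order.join V W) = theory V `&` theory W.
Proof.
have fV := theory_fully_invariant V; have fW := theory_fully_invariant W.
apply: theory_models; split=> [u|u v|v u w|u v u' v'|sigma u v] /=.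
- by split; [exact: (fi_refl fV)|exact: (fi_refl fW)].
- by case=> Vu Wu; split; [exact: (fi_sym fV)|exact: (fi_sym fW)].
- by case=> Vu Wu [Vv Wv]; split; [exact: (fi_trans fV Vu)|exact: (fi_trans fW Wu)].
- by case=> ? ? [? ?]; split; [exact: (fi_mul fV)|exact: (fi_mul fW)].
- by case=> *; split; [exact: (fi_subst fV)|exact: (fi_subst fW)].
Qed.

(** The theory of a meet is generated by the two theories; this is its universal
    property, which spares describing the derivations. *)
Lemma theory_meet_sub (V W : variety) E : fully_invariant E ->
  theory V `<=` E -> theory W `<=` E -> theory (Order.meet V W) `<=` E.
Proof.
move=> fiE VE WE; apply/defined_by_le => //; rewrite lexI.
by apply/andP; split; apply/defined_by_le.
Qed.

(** * Nil semigroups without irreducible elements *)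

(** The exponent is shifted: [power x n] is x^(n+1). *)
Definition power (S : semigroup) (x : S) (n : nat) : S :=
  word_val (fun=> x) (0, nseq n 0).

Lemma powerS (S : semigroup) (x : S) n : power x n.+1 = x ** power x n.
Proof. by rewrite /power !word_val_act /= word_act_mul. Qed.

Lemma powerD (S : semigroup) (x : S) m n :
  power x m ** power x n = power x (m + n).+1.
Proof. by elim: m => [|m IHm]; rewrite powerS // -sg_mulA IHm -powerS. Qed.

Lemma iterop_power (S : semigroup) (x : S) n :
  iterop n.+1 (@sg_mul S) x x = power x n.
Proof. by elim: n => // n IHn; rewrite powerS -IHn. Qed.

Lemma powerSr (S : semigroup) (x : S) n : power x n.+1 = power x n ** x.
Proof. by rewrite -{3}[x]/(power x 0) powerD addn0. Qed.

(** Here S is nil with S = S^2, and u = v is an identity of S whose left-hand side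
    is linear.  Since every element is a product of arbitrarily many elements, the
    letters of u can be given values with a prescribed product; the letters
    themselves are then almost at our disposal.  The identity is used inside
    longer products, [a u c = a v c], so that no prefix or suffix of u needs to be
    nonempty. *)
Section IdempotentNil.
Variables (S : semigroup) (z0 : S).
Hypothesis z0P : is_zero z0.
Hypothesis nilS : forall x : S, exists n, power x n = z0.
Hypothesis idemS : forall t : S, exists a b, t = a ** b.

(** The valuation may be changed on s only, so that factorizations along disjoint
    parts of a linear word can be combined one after the other. *)
Lemma factor_left (s : seq nat) (g : nat -> S) (t : S) : uniq s ->
  exists f a, word_act f a s = t /\ forall i, i \notin s -> f i = g i.
Proof.
elim/last_ind: s t => [|s j IHs] t; first by exists g, t.
rewrite rcons_uniq => /andP[sj us]; have [a [b ->]] := idemS t.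
have [f [a0 [fa fg]]] := IHs a us.
exists (fun i => if i == j then b else f i), a0; split=> [|i].
  rewrite -cats1 word_act_cat /= eqxx -fa; congr (_ ** _).
  by apply: eq_in_word_act => i si; case: eqP sj => // <-; rewrite si.
by rewrite mem_rcons inE negb_or => /andP[/negbTE -> /fg].
Qed.

(** The part of c that is left over stays in P; it is used below with P an ideal
    that keeps track of the occurrences of a given element. *)
Lemma factor_right (P : S -> Prop) (s : seq nat) (g : nat -> S) (c : S) :
  (forall c, P c -> exists b c', P c' /\ c = b ** c') -> P c -> uniq s ->
  exists f c', [/\ P c', forall e, word_act f e s ** c' = e ** c &
                   forall i, i \notin s -> f i = g i].
Proof.
move=> splitP; elim: s c => [|j s IHs] c Pc; first by exists g, c.
move=> /= /andP[sj us]; have [b [c1 [Pc1 ->]]] := splitP c Pc.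
have [f [c' [Pc' fc fg]]] := IHs c1 Pc1 us.
exists (fun i => if i == j then b else f i), c'; split=> // [e|i].
  rewrite eqxx sg_mulA -fc; congr (_ ** _).
  by apply: eq_in_word_act => i si; case: eqP sj => // <-; rewrite si.
by rewrite inE negb_or => /andP[/negbTE -> /fg].
Qed.

Lemma idem_factor (c : S) : True -> exists b c', True /\ c = b ** c'.
Proof. by move=> _; have [b [c' ->]] := idemS c; exists b, c'. Qed.

Lemma word_act_ideal (P : S -> Prop) (f : nat -> S) x s c :
  (forall b c, P c -> P (b ** c)) -> P c ->
  exists2 r, P r & word_act f x s ** c = x ** r.
Proof.
move=> idealP; elim: s x => [|i s IHs] x Pc; first by exists c.
have [r Pr E] := IHs (x ** f i) Pc.
by exists (f i ** r); [exact: idealP|rewrite /= E sg_mulA].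
Qed.

(** Containing arbitrarily high powers of one element z forces an element to be
    zero, as some power of z vanishes. *)
Lemma zero_of_absorb (e z : S) :
  (forall m, exists a b, e = a ** power z m ** b) ->
  e = z0.
Proof.
move=> H; have [n zn] := nilS z; have [a [b ->]] := H n.
by rewrite zn (z0P a).2 (z0P b).1.
Qed.

Lemma zero_of_factor (P : S -> Prop) : (forall t, P t -> t = z0) ->
  (forall a b z c : S, P (a ** b ** z ** c)) -> forall t, t = z0.
Proof.
move=> P0 HP t; have [x [c ->]] := idemS t; have [y [z ->]] := idemS x.
by have [a [b ->]] := idemS y; exact/P0/HP.
Qed.

Variables (u v : seq nat).
Hypothesis uniq_u : uniq u.
Hypothesis id_uv : forall (f : nat -> S) (a c : S),
  word_act f a u ** c = word_act f a v ** c.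

(** Let p be the longest common prefix of u and v, after which v continues with
    the letter y.  When y occurs in p, giving it the value z shows that
    [a z b r = a z b z r'] for suitable r'.  Absorbing z into b and repeating yields
    arbitrarily high powers of z. *)
Lemma zero_of_early (p u' v' : seq nat) y :
  u = p ++ u' -> v = p ++ y :: v' -> y \in p -> forall t : S, t = z0.
Proof.
move=> uE vE py.
have step (a z b r : S) : exists r' : S, a ** z ** b ** r = a ** z ** b ** z ** r'.
  case/splitPr: py uE vE => p1 p2 uE vE; move: uniq_u.
  rewrite uE cat_uniq => /and3P[].
  rewrite cat_uniq => /and3P[up1 /= /norP[yp1 p12] /andP[yp2 up2]] pu' uu'.
  have [f1 [b' [f1b _]]] := factor_left (fun=> a) b up2.
  (* When y is the last letter of p, b has to be part of the value of y. *)
  pose g1 i := if i == y then z ** b' else f1 i.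
  have [f2 [a0 [f2a f2g]]] := factor_left g1 a up1.
  have [f [c [_ fc ff2]]] := factor_right f2 idem_factor (I : (fun=> True) r) uu'.
  have f_p : {in p1 ++ y :: p2, f =1 f2}.
    move=> i pi; apply: ff2; apply/negP => u'i; case/hasP: pu'.
    by exists i.
  have fp : word_act f a0 (p1 ++ y :: p2) = a ** z ** b.
    rewrite (eq_in_word_act _ f_p) word_act_cat f2a /= f2g // /g1 eqxx.
    rewrite sg_mulA word_act_mul; congr (_ ** _); rewrite -f1b.
    apply: eq_in_word_act => i pi; rewrite f2g /g1.
      by case: eqP yp2 => // <-; rewrite pi.
    by apply/negP => p1i; case/hasP: p12; exists i.
  have fy : f y = z ** b' by rewrite f_p ?mem_cat ?mem_head ?orbT // f2g // /g1 eqxx.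
  have := id_uv f a0 c; rewrite uE vE !(word_act_cat _ _ (_ ++ _)) fp fc /= fy.
  rewrite sg_mulA word_act_mul -!sg_mulA => ->.
  by eexists; rewrite !sg_mulA -!sg_mulA; reflexivity.
have repeat (a z b r : S) m :
    exists r' : S, a ** z ** b ** r = a ** z ** b ** power z m ** r'.
  elim: m => [|m [r' ->]]; first exact: step.
  have [r2] := step a z (b ** power z m) r'.
  by rewrite !sg_mulA => ->; exists r2; rewrite powerSr !sg_mulA.
apply: (@zero_of_factor (fun t => exists a z b r : S, t = a ** z ** b ** r)).
  move=> _ [a [z [b [r ->]]]]; apply: (@zero_of_absorb _ z) => m.
  have [r' ->] := repeat a z b r m; by exists (a ** z ** b), r'.
by move=> a b z c; exists a, b, z, c.
Qed.

(** [many z m] is the left ideal of the products S z S z ... z S with m factors z.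
    Only separated occurrences of z are counted, because these are the ones that
    can be moved to the front. *)
Fixpoint many (z : S) (m : nat) (t : S) : Prop :=
  if m is m'.+1 then exists a c, many z m' c /\ t = a ** z ** c else True.

Lemma many_ideal z m b c : many z m c -> many z m (b ** c).
Proof.
case: m => //= m [a [c' [mc' ->]]]; exists (b ** a), c'; split=> //.
by rewrite !sg_mulA.
Qed.

Lemma many_factor z m c : many z m c -> exists b c', many z m c' /\ c = b ** c'.
Proof.
case: m => [_|m [a [c' [mc' ->]]]] /=.
  by have [x [x' ->]] := idemS c; exists x, x'.
have [x [x' ->]] := idemS a; exists x, (x' ** z ** c'); split.
  by exists x', c'.
by rewrite !sg_mulA.
Qed.

(** When y occurs in u only after the longest common prefix p, and not immediately
    after it, the identity moves an element z from inside a product to the place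
    just after a prefix a: [a b z c = a z c'], where c' still contains the
    occurrences of z counted in c ([pull]).  On the
    other hand a letter w occurring twice in v shows that a product in which z
    occurs can be rewritten so that z occurs twice ([double]).  So z can be made to
    occur as often as desired, and all these occurrences can then be collected
    behind a into a high power of z. *)
Lemma zero_of_late (p b' c' v' v1 v2 v3 : seq nat) x y w :
  u = p ++ x :: b' ++ y :: c' -> v = p ++ y :: v' ->
  w \in u -> v = v1 ++ w :: v2 ++ w :: v3 -> forall t : S, t = z0.
Proof.
move=> uE vE uw vEw.
have double (a z b : S) : exists a' c b', a ** z ** b = a' ** z ** c ** z ** b'.
  case/splitPr: uw (uniq_u) (id_uv) => u1 u2.
  rewrite cat_uniq => /and3P[uu1 /= /norP[wu1 u12] /andP[wu2 uu2]] id.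
  have [a1 [a2 ->]] := idemS a; have [b1 [b2 ->]] := idemS b.
  (* The factors a2 and b1 keep the copies of z separated. *)
  pose g1 := fun _ : nat => a2 ** z ** b1.
  have [f2 [a0 [f2a f2g]]] := factor_left g1 a1 uu1.
  have [f [c [_ fc ff2]]] := factor_right f2 idem_factor (I : (fun=> True) b2) uu2.
  have fw : f w = a2 ** z ** b1 by rewrite ff2 // f2g.
  have fu1 : word_act f a0 u1 = a1.
    rewrite -f2a; apply: eq_in_word_act => i u1i; apply: ff2.
    by apply/negP => u2i; case/hasP: u12; exists i.
  have := id f a0 c; rewrite vEw !word_act_cat /= word_act_cat /= fu1 fw fc.
  rewrite !sg_mulA !(word_act_mul, sg_mulA) => E.
  exists (word_act f a0 v1 ** a2), (word_act f b1 v2 ** a2).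
  exists (word_act f b1 v3 ** c).
  by rewrite E !sg_mulA.
have many_all m : forall a z b : S, many z m (a ** z ** b).
  elim: m => //= m IHm a z b; have [a' [c [b1 ->]]] := double a z b.
  by exists a', (c ** z ** b1); split; [exact: IHm|rewrite !sg_mulA].
have pull m (a b z c : S) : many z m c ->
    exists c1, many z m c1 /\ a ** b ** z ** c = a ** z ** c1.
  move=> mc; move: (uniq_u); rewrite uE.
  rewrite cat_uniq => /and3P[up /= /norP[xp pu] /andP[]].
  rewrite mem_cat inE => /norP[xb' /norP[xy xc']].
  rewrite cat_uniq => /and3P[ub' /= /norP[yb' bc'] /andP[yc' uc']].
  have [f1 [b1 [f1b _]]] := factor_left (fun=> a) b ub'.
  pose g1 i := if i == x then b1 else if i == y then z else f1 i.
  have [f2 [a0 [f2a f2g]]] := factor_left g1 a up.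
  have [f [d [md fd ff2]]] :=
    factor_right f2 (@many_factor z m) mc uc'.
  have yp : y \notin p.
    by apply/negP => py; case/hasP: pu; exists y; rewrite // mem_cat mem_head orbT.
  have fp : word_act f a0 p = a.
    rewrite -f2a; apply: eq_in_word_act => i pi; apply: ff2.
    apply/negP => ci; case/hasP: pu; exists i => //.
    by rewrite mem_cat inE ci !orbT.
  have fx : f x = b1 by rewrite ff2 // f2g // /g1 eqxx.
  have fy : f y = z by rewrite ff2 // f2g // /g1 eq_sym (negbTE xy) eqxx.
  have fb : word_act f b1 b' = b.
    rewrite -f1b; apply: eq_in_word_act => i bi; rewrite ff2; last first.
      by apply/negP => ci; case/hasP: bc'; exists i.
    rewrite f2g; last first.
      by apply/negP => pi; case/hasP: pu; exists i; rewrite // mem_cat bi.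
    rewrite /g1; case: eqP xb' => [<-|_ _]; first by rewrite bi.
    by case: eqP yb' => // <-; rewrite bi.
  have := id_uv f a0 d.
  rewrite uE vE !word_act_cat /= !word_act_cat /= fp fx fy.
  rewrite (word_act_mul f a b1) fb.
  rewrite fd => ->.
  have [r mr ->] := word_act_ideal f (a ** z) v' (@many_ideal z m) md.
  by exists r.
have pull_all m : forall a c z : S, many z m.+1 c ->
    exists r, a ** c = a ** power z m ** r.
  elim: m => [|m IHm] a c z [b [d [md ->]]].
    by have [c1 [_]] := @pull 0 a b z d md; rewrite !sg_mulA => ->; exists c1.
  have [c1 [mc1]] := pull m.+1 a b z d md; rewrite !sg_mulA => ->.
  by have [r ->] := IHm (a ** z) c1 z mc1; exists r; rewrite powerS !sg_mulA.
apply: (@zero_of_factor (fun t => exists a b z c : S, t = a ** (b ** z ** c))).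
  move=> _ [a [b [z [c ->]]]]; apply: (@zero_of_absorb _ z) => m.
  by have [r ->] := pull_all m a _ z (many_all m.+1 b z c); exists a, r.
by move=> a b z c; exists a, b, z, c; rewrite !sg_mulA.
Qed.

End IdempotentNil.

(** * Identities with a linear side in nil semigroups *)

Lemma not_uniq_split (s : seq nat) : ~~ uniq s ->
  exists w s1 s2 s3, s = s1 ++ w :: s2 ++ w :: s3.
Proof.
elim: s => //= i s IHs; rewrite negb_and negbK => /orP[|/IHs].
  by case/splitPr=> s2 s3; exists i, [::], s2, s3.
by case=> w [s1 [s2 [s3 ->]]]; exists w, (i :: s1), s2, s3.
Qed.

Lemma first_mismatch (s t : seq nat) : size s < size t ->
  exists p s' y t', [/\ s = p ++ s', t = p ++ y :: t' & ohead s' != Some y].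
Proof.
elim: s t => [|x s IHs] [|y t] // st; first by exists [::], [::], y, t.
have [->|xy] := eqVneq x y.
  have [p [s' [y' [t' [-> -> H]]]]] := IHs t st.
  by exists (y :: p), s', y', t'.
by exists [::], (x :: s), y, t.
Qed.

Section Powers.
Variable S : semigroup.

Lemma semigroup_powerS n :
  semigroup_power S n.+2 = [set a ** b | a in semigroup_power S n.+1 & b in [set: S]].
Proof. by []. Qed.

Lemma semigroup_power_sub m n : m <= n ->
  semigroup_power S n.+1 `<=` semigroup_power S m.+1.
Proof.
elim: n m => [|n IHn] [|m] //= mn; rewrite !semigroup_powerS => _ [a an [b _ <-]].
by exists a; [exact: IHn an|exists b].
Qed.

Lemma word_val_power (f : nat -> S) w :
  semigroup_power S (size (letters w)) (word_val f w).
Proof.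
case: w => i s; elim/last_ind: s => [|s j IHs] //.
rewrite /= size_rcons semigroup_powerS; exists (word_val f (i, s)); first exact: IHs.
by exists (f j) => //; rewrite !word_val_act /= -cats1 word_act_cat.
Qed.

(** A linear word takes all the values that its length allows. *)
Lemma power_word_val u t : uniq (letters u) ->
  semigroup_power S (size (letters u)) t -> exists f, t = word_val f u.
Proof.
case: u => i s; elim/last_ind: s t => [|s j IHs] t; first by exists (fun=> t).
rewrite /letters -rcons_cons rcons_uniq => /andP[sj us].
rewrite size_rcons semigroup_powerS => -[a /IHs-/(_ us)[f ->] [b _ <-]].
exists (fun k => if k == j then b else f k).
rewrite -cats1 -[(i, s ++ _)]/(word_mul (i, s) (j, [::])) word_val_mul.
congr (_ ** _); last by rewrite /word_val /= eqxx.
by apply: eq_in_word_val => k sk; case: eqP sj => // <-; rewrite sk.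
Qed.

Lemma semigroup_power_split m n t : semigroup_power S (m + n).+2 t ->
  exists a b, [/\ semigroup_power S m.+1 a, semigroup_power S n.+1 b & t = a ** b].
Proof.
elim: n t => [|n IHn] t.
  by rewrite addn0 semigroup_powerS => -[a am [b _ <-]]; exists a, b.
rewrite addnS semigroup_powerS => -[c /IHn[a [b [am bn ->]]] [d _ <-]].
exists a, (b ** d); split; rewrite ?sg_mulA // semigroup_powerS.
by exists b => //; exists d.
Qed.

End Powers.

Section NilPower.
Variables (S : semigroup) (z0 : S).
Hypothesis z0P : is_zero z0.
Hypothesis nilS : forall x : S, exists n, power x n = z0.

Lemma word_act_zero f s : word_act f z0 s = z0.
Proof. by elim: s => //= i s; rewrite (z0P _).1. Qed.

Lemma word_val_zero f w i : i \in letters w -> f i = z0 -> word_val f w = z0.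
Proof.
case: w => j s; rewrite inE /= word_val_act => /predU1P[<- /= ->|].
  exact: word_act_zero.
by case/splitPr=> s1 s2 /= fi; rewrite word_act_cat /= fi (z0P _).2 word_act_zero.
Qed.

Lemma power_zero n : power z0 n = z0.
Proof. exact: (@word_val_zero _ _ 0). Qed.

Lemma zero_power n : semigroup_power S n.+1 z0.
Proof.
have := word_val_power (fun=> z0) (0, nseq n 0).
by rewrite /= size_nseq -/(power z0 n) power_zero.
Qed.

(** As S^(n+1) is contained in S^(n+2), the ideal S^(n+1) is equal to its own
    square, and to it the results on semigroups S = S^2 apply. *)
Section Idempotent.
Variable n : nat.
Hypothesis idem : semigroup_power S n.+1 `<=` semigroup_power S n.+2.

Definition ideal := {t : S | semigroup_power S n.+1 t}.

Lemma ideal_inj (x y : ideal) : sval x = sval y -> x = y.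
Proof. by case: x y => x px [y py] /= xy; apply: eq_exist. Qed.

Lemma ideal_mul_subproof (x y : ideal) :
  semigroup_power S n.+1 (sval x ** sval y).
Proof.
apply: (@semigroup_power_sub S n n.+1) => //; rewrite semigroup_powerS.
by exists (sval x); [exact: svalP|exists (sval y)].
Qed.

Definition ideal_mul (x y : ideal) : ideal :=
  exist _ (sval x ** sval y) (ideal_mul_subproof x y).

Lemma ideal_mulA : associative ideal_mul.
Proof. by move=> x y z; apply: ideal_inj; rewrite /= sg_mulA. Qed.

Definition ideal_zero : ideal := exist _ z0 (zero_power n).

Definition ideal_semigroup : semigroup :=
  @Defs.Semigroup ideal ideal_mul ideal_mulA (inhabits ideal_zero).

Lemma ideal_word_val (f : nat -> ideal_semigroup) w :
  sval (word_val f w) = word_val (fun i => sval (f i)) w.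
Proof. exact: (@morphism_word_val ideal_semigroup S (@sval _ _)). Qed.

Lemma ideal_factor (t : ideal_semigroup) : exists a b, t = a ** b.
Proof.
have sub k : semigroup_power S n.+1 `<=` semigroup_power S (n + k).+1.
  elim: k => [|k IHk]; first by rewrite addn0.
  apply: (subset_trans idem); rewrite addnS !semigroup_powerS => _ [a an [b _ <-]].
  by exists a; [exact: IHk|exists b].
have /semigroup_power_split : semigroup_power S (n + n).+2 (sval t).
  by rewrite -addnS; apply/sub/svalP.
move=> [a [b [an bn tE]]]; exists (exist _ a an), (exist _ b bn).
exact: ideal_inj.
Qed.

End Idempotent.

(** If a letter occurs on one side only, giving it the value 0 makes both sides
    vanish.  Otherwise v is longer than u, since it is not a permutation of u; then
    S^n, with n the length of u, is contained in S^(n+1), so that S^n is a nil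
    semigroup equal to its square, and satisfies u = v.  The first place at which v
    differs from u decides whether [zero_of_early] or [zero_of_late] shows that this
    semigroup is zero. *)
Lemma nil_power_zero u v : satisfies S (u, v) -> uniq (letters u) ->
  ~~ perm_eq (letters u) (letters v) ->
  semigroup_power S (size (letters u)) = [set z0].
Proof.
move=> uv uu nperm; have uvE f : word_val f u = word_val f v := uv f.
suff H f : word_val f u = z0.
  apply/seteqP; split=> [t /power_word_val[//|f ->]|_ ->]; last exact: zero_power.
  exact: H.
have [uv_sub|/allPn[x ux vx]] := boolP (all (mem (letters v)) (letters u)); last first.
  have [fx fv] : word_val (fun i => if i == x then z0 else f i) u = z0 /\
      word_val (fun i => if i == x then z0 else f i) v = word_val f v.
    split; first by apply: (@word_val_zero _ _ x); rewrite ?eqxx.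
    by apply: eq_in_word_val => i vi; case: eqP vx => // <-; rewrite [mem _ _]vi.
  by rewrite uvE -fv -uvE.
have [vu_sub|/allPn[x vx ux]] := boolP (all (mem (letters u)) (letters v)); last first.
  have fu : word_val (fun i => if i == x then z0 else f i) u = word_val f u.
    by apply: eq_in_word_val => i ui; case: eqP ux => // <-; rewrite [mem _ _]ui.
  by rewrite -fu uvE; apply: (@word_val_zero _ _ x); rewrite ?eqxx.
have eq_uv : letters u =i letters v.
  by move=> i; apply/idP/idP => [/(allP uv_sub)|/(allP vu_sub)].
have vv : ~~ uniq (letters v) by apply: contra nperm => vv; apply: uniq_perm.
have lt_uv : size (letters u) < size (letters v).
  rewrite ltn_neqAle uniq_leq_size ?andbT //; last by move=> i; rewrite eq_uv.
  by apply: contra vv => e; rewrite (uniq_size_uniq uu eq_uv) eq_sym.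
pose n := size u.2.
have idem : semigroup_power S n.+1 `<=` semigroup_power S n.+2.
  move=> t /power_word_val-/(_ uu)[g ->]; rewrite uvE.
  exact: (@semigroup_power_sub S n.+1 (size v.2) lt_uv _ (word_val_power g v)).
pose T := ideal_semigroup n.
have nilT (t : T) : exists k, power t k = ideal_zero n.
  have [k tk] := nilS (sval t); exists k; apply: ideal_inj.
  by rewrite -[RHS]tk /power (@ideal_word_val n).
have zeroT : is_zero (ideal_zero n : T).
  by move=> t; split; apply: ideal_inj; rewrite /= ?(z0P _).1 ?(z0P _).2.
have idT (g : nat -> T) (a c : T) :
    word_act g a (letters u) ** c = word_act g a (letters v) ** c.
  rewrite !word_act_letters; congr (_ ** _ ** _); apply: ideal_inj.
  by rewrite !ideal_word_val; exact: uvE.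
suff T0 (t : T) : t = ideal_zero n.
  by have := congr1 (@sval _ _) (T0 (exist _ _ (word_val_power f u))).
have [p [u' [y [v' [uE vE uv']]]]] := first_mismatch lt_uv.
have [py|py] := boolP (y \in p).
  exact: (zero_of_early zeroT nilT (ideal_factor idem) uu idT uE vE py).
have: y \in letters u by rewrite eq_uv vE mem_cat mem_head orbT.
rewrite uE mem_cat (negbTE py) /= => u'y.
case/splitPr: u'y uv' uE => [[|x b'] c'] /=; first by rewrite eqxx.
move=> _ uE; have [w [v1 [v2 [v3 vwE]]]] := not_uniq_split vv.
apply: (zero_of_late zeroT nilT (ideal_factor idem) uu idT uE vE _ vwE).
by rewrite eq_uv vwE mem_cat mem_head orbT.
Qed.

End NilPower.

(** * Linear words up to permutation of letters *)

Section Thresholds.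
Variable N : pred nat.

(** The words whose value is zero: N is meant to be upward closed, and holds of the
    lengths n for which x_1 ... x_n = 0 is imposed.  With N empty the theory below
    is that of x^2 = 0, xy = yx. *)
Definition collapsed (w : word) : bool :=
  ~~ uniq (letters w) || N (size (letters w)).

Definition linear_theory : set identity :=
  [set u | perm_eq (letters u.1) (letters u.2) \/
           collapsed u.1 /\ collapsed u.2].

Hypothesis N_up : forall m n, m <= n -> N m -> N n.

Lemma collapsed_perm u v :
  perm_eq (letters u) (letters v) -> collapsed u = collapsed v.
Proof. by move=> uv; rewrite /collapsed (perm_uniq uv) (perm_size uv). Qed.

Lemma collapsed_mul u v :
  collapsed u || collapsed v -> collapsed (word_mul u v).
Proof.
rewrite /collapsed letters_mul cat_uniq size_cat.
case/orP=> /orP[/negbTE->|H]; rewrite ?andbF //.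
- by rewrite (N_up _ H) ?leq_addr ?orbT.
- by rewrite (N_up _ H) ?leq_addl ?orbT.
Qed.

Lemma collapsed_subst sigma w : collapsed w -> collapsed (subst sigma w).
Proof.
rewrite /collapsed letters_subst => /orP[]; last first.
  move=> Nw; apply/orP; right; apply: N_up Nw.
  by elim: (letters w) => //= i s IHs; rewrite size_cat ltnS (leq_trans IHs) ?leq_addl.
move=> /not_uniq_split[i [s1 [s2 [s3 ->]]]]; apply/orP; left.
rewrite !(map_cat, flatten_cat) /= !(map_cat, flatten_cat) /=.
apply/negP; rewrite cat_uniq => /and3P[_ _]; rewrite -cat_cons cat_uniq.
case/and3P=> _ /hasPn/(_ (sigma i).1).
by rewrite mem_cat mem_head orbT inE eqxx => /(_ isT).
Qed.

Lemma linear_theory_fi : fully_invariant linear_theory.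
Proof.
split=> [u|u v|v u w|u v u' v'|sigma u v] /=.
- by left.
- by case=> [|[]]; [left; rewrite perm_sym|right].
- case=> [uv|[Bu Bv]] [vw|[Bv' Bw]]; first by left; apply: perm_trans uv vw.
  + by right; rewrite (collapsed_perm uv).
  + by right; rewrite -(collapsed_perm vw).
  + by right.
- case=> [uv|[Bu Bv]]; last by right; rewrite !collapsed_mul ?Bu ?Bv.
  case=> [uv'|[Bu Bv]]; last by right; rewrite !collapsed_mul ?Bu ?Bv ?orbT.
  by left; rewrite !letters_mul perm_cat.
- case=> [uv|[Bu Bv]]; last by right; rewrite !collapsed_subst.
  by left; rewrite !letters_subst perm_flatten // perm_map.
Qed.

End Thresholds.

(** * Degree and the linear varieties *)

Definition nil_zero (S : semigroup) (z : S) : Prop :=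
  is_zero z /\ forall x : S, exists n, power x n = z.

Lemma nilsemigroupP (S : semigroup) :
  nilsemigroup S <-> exists z : S, nil_zero z.
Proof.
split=> [[z z0 nil]|[z [z0 nil]]].
  exists z; split=> // x; have [[//|n] _ <-] := nil x.
  by exists n; rewrite iterop_power.
by exists z => // x; have [n <-] := nil x; exists n.+1; rewrite ?iterop_power.
Qed.

Lemma zero_unique (S : semigroup) (y z : S) : is_zero y -> is_zero z -> y = z.
Proof. by move=> yP zP; rewrite -(yP z).1 (zP y).2. Qed.

(** An identity of V that fails in the variety given by N has a linear side whose
    length is not in N; nil semigroups in V vanish at that length. *)
Lemma not_linear_le (N : pred nat) (V : variety) : (forall m n, m <= n -> N m -> N n) ->
  ~ (defined_by (linear_theory N) <= V)%O ->
  exists n, ~~ N n.+1 /\ forall (S : semigroup) (z : S), variety_class V S ->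
    nil_zero z -> semigroup_power S n.+1 = [set z].
Proof.
move=> N_up /(not_defined_by_le (linear_theory_fi N_up))[u [v [uv /= Euv]]].
have nperm : ~~ perm_eq (letters u) (letters v) by apply/negP => ?; apply: Euv; left.
have key w w' : theory V (w, w') -> ~~ perm_eq (letters w) (letters w') ->
    ~~ collapsed N w -> exists n, ~~ N n.+1 /\
      forall (S : semigroup) (z : S), variety_class V S ->
      nil_zero z -> semigroup_power S n.+1 = [set z].
  move=> ww' nww'; rewrite negb_or negbK => /andP[uw Nw].
  exists (size w.2); split=> //.
  by move=> S z VS [z0 nil]; apply: (nil_power_zero z0 nil (ww' S VS) uw nww').
have [Cu|Cu] := boolP (collapsed N u); last exact: key uv nperm Cu.
have [Cv|Cv] := boolP (collapsed N v); first by case: Euv; right.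
by apply: key Cv; [exact: (fi_sym (theory_fully_invariant V)) uv|rewrite perm_sym].
Qed.

Definition linear_limit : variety := defined_by (linear_theory pred0).
Definition linear_variety (k : nat) : variety := defined_by (linear_theory (leq k)).

Lemma pred0_up m n : m <= n -> (pred0 : pred nat) m -> (pred0 : pred nat) n.
Proof. by []. Qed.

Lemma leq_up k m n : m <= n -> leq k m -> leq k n.
Proof. by move=> mn km; apply: leq_trans mn. Qed.

Lemma linear_theory_sub (M N : pred nat) : {subset M <= N} ->
  linear_theory M `<=` linear_theory N.
Proof.
move=> MN [u v] [uv|[Cu Cv]]; [by left|right].
have C w : collapsed M w -> collapsed N w.
  by case/orP=> [Uw|Mw]; rewrite /collapsed ?Uw // [N _]MN ?orbT.
by split; apply: C.
Qed.

Lemma linear_variety_le_limit k : (linear_variety k <= linear_limit)%O.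
Proof.
apply/le_defined_by; rewrite theory_models; last exact: linear_theory_fi (@leq_up k).
exact: linear_theory_sub.
Qed.

Lemma linear_variety_mono j k : j <= k -> (linear_variety j <= linear_variety k)%O.
Proof.
move=> jk; apply/le_defined_by.
rewrite theory_models; last exact: linear_theory_fi (@leq_up j).
by apply: linear_theory_sub => m; apply: leq_trans.
Qed.

(** The word x_0 ... x_(k-1) is zero in F_k, but N k fails, so it is nonzero in
    the other variety. *)
Lemma linear_not_le (N : pred nat) k : 0 < k -> ~~ N k ->
  (forall m n, m <= n -> N m -> N n) ->
  ~ (defined_by (linear_theory N) <= linear_variety k)%O.
Proof.
case: k => // k _ Nk N_up /(defined_by_le _ (linear_theory_fi N_up)).
rewrite theory_models; last exact: linear_theory_fi (@leq_up k.+1).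
move=> /(_ ((0, iota 1 k), (0, nseq k.+1 0))) /=; case.
- by right; split; rewrite /collapsed /= ?size_iota ?leqnn ?orbT.
- move=> /perm_size /=; rewrite size_iota size_nseq => /eqP.
  by rewrite eqn_leq ltnn andbF.
- case=> + _; rewrite /collapsed /= size_iota (negbTE Nk) orbF.
  by rewrite iota_uniq mem_iota.
Qed.

(** All squares are equal, and their common value is a zero. *)
Lemma square_nil_zero (W : variety) (S : semigroup) (x : S) :
  (W <= linear_limit)%O -> variety_class W S -> nil_zero (x ** x).
Proof.
move=> /le_defined_by WF WS.
have sat u v : ~~ uniq (letters u) -> ~~ uniq (letters v) -> satisfies S (u, v).
  by move=> uu uv; apply: (WF (u, v)) => //; right; rewrite /collapsed uu uv.
have zero (y : S) : y ** y = x ** x.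
  exact: (sat (0, [:: 0]) (1, [:: 1]) isT isT (fun i => if i is 0 then y else x)).
split=> y; last by exists 1; exact: zero.
pose f i := if i is 0 then x else y; split.
  exact: (sat (0, [:: 0; 1]) (0, [:: 0]) isT isT f).
by have := sat (1, [:: 0; 0]) (0, [:: 0]) isT isT f; rewrite /word_val /= -sg_mulA.
Qed.

Lemma le_linear_variety_of_power (W : variety) n : (W <= linear_limit)%O ->
  (forall (S : semigroup) (z : S), variety_class W S ->
    nil_zero z -> semigroup_power S n.+1 = [set z]) -> (W <= linear_variety n.+1)%O.
Proof.
move=> WF Wn; have /le_defined_by WE := WF; apply/le_defined_by => -[u v] uv S WS.
case: uv => [uv|[Cu Cv]]; first by apply: WE => //; left.
suff H w (f : nat -> S) : collapsed (leq n.+1) w -> word_val f w = f 0 ** f 0.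
  by move=> f /=; rewrite !H.
case/orP=> [Uw|nw]; last first.
  have := Wn S _ WS (square_nil_zero (f 0) WF WS).
  move/seteqP => [+ _]; apply.
  exact: (@semigroup_power_sub S n (size w.2) nw) (word_val_power f w).
apply: (WE (w, (0, [:: 0]))) => //; right.
by rewrite /collapsed Uw.
Qed.

(** Below F the variety F_k is the largest one not containing F_(k+1); this makes
    the subvarieties of F a chain. *)
Lemma linear_variety_cover (W : variety) k : (W <= linear_limit)%O ->
  ~ (linear_variety k.+1 <= W)%O -> (W <= linear_variety k)%O.
Proof.
move=> WF /(not_linear_le (@leq_up k.+1))[n []].
rewrite -ltnNge ltnS => nk Wn; apply: le_trans (linear_variety_mono nk).
exact: le_linear_variety_of_power.
Qed.

Lemma linear_limit_cover (W : variety) : (W <= linear_limit)%O ->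
  ~ (linear_limit <= W)%O -> exists k, (W <= linear_variety k.+1)%O.
Proof.
move=> WF /(not_linear_le pred0_up)[n [_ Wn]]; exists n.
exact: le_linear_variety_of_power.
Qed.

Lemma linear_variety1_le (V : variety) : (linear_variety 1 <= V)%O.
Proof.
apply/defined_by_le; first exact: linear_theory_fi (@leq_up 1).
by move=> [u v] _; right; rewrite /collapsed !orbT.
Qed.

(** The free semigroup of the variety given by N: a product of j distinct
    generators is zero only if N j holds. *)
Lemma linear_free_nilpotent (N : pred nat) (V : variety)
    (N_up : forall m n, m <= n -> N m -> N n) :
  (defined_by (linear_theory N) <= V)%O ->
  exists S : semigroup, [/\ variety_class V S, nilsemigroup S &
    forall j, nilpotent_with S j -> N j].
Proof.
move=> Nk; have fiN := linear_theory_fi N_up.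
pose S := rel_free fiN; have VS : variety_class (defined_by (linear_theory N)) S.
  exact: rel_free_models.
have SF : (defined_by (linear_theory N) <= linear_limit)%O.
  by apply/le_defined_by; rewrite theory_models //; apply: linear_theory_sub.
exists S; split; first by move/asboolP: Nk; apply.
  pose x : S := free_pi fiN (0, [::]).
  by apply/nilsemigroupP; exists (x ** x); apply: square_nil_zero VS.
case=> [[//]|j] [_ [z zP Sz]].
have := word_val_power (fun i => free_pi fiN (i, [::]) : S) (0, iota 1 j).
rewrite [size _]/= size_iota Sz /= rel_free_letters => pz.
have zz : free_pi fiN (0, [:: 0]) = z.
  apply: zero_unique zP; rewrite -rel_free_letters.
  by have [] := @square_nil_zero _ S (free_pi fiN (0, [::])) SF VS.
have lin_uniq : uniq (0 :: iota 1 j) by rewrite /= mem_iota iota_uniq.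
move: pz; rewrite -zz => /free_pi_eq[/perm_uniq|[]].
  by rewrite /letters lin_uniq.
by rewrite /collapsed /letters lin_uniq /= size_iota.
Qed.

Lemma finite_degreeP (V : variety) : finite_degree V <-> ~ (linear_limit <= V)%O.
Proof.
split=> [fdV /(linear_free_nilpotent pred0_up)[S [VS nil nN]]|].
  by have [k /nN] := fdV S VS nil.
move=> /(not_linear_le pred0_up)[n [_ Vn]] S VS /nilsemigroupP[z zS].
by exists n.+1; split=> //; exists z; [have [] := zS|exact: Vn].
Qed.

(** The restriction to positive k comes from trivial semigroups, which have
    nilpotency degree 1. *)
Lemma degree_boundedP (V : variety) k :
  degree_bounded V k <-> 0 < k /\ ~ (linear_variety k.+1 <= V)%O.
Proof.
split=> [dV|[k0 /(not_linear_le (@leq_up k.+1))[n [+ Vn]]] S VS /nilsemigroupP[z zS]].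
  split.
    have [S [VS nil _]] := linear_free_nilpotent (@leq_up 1) (linear_variety1_le V).
    by have [j [[j0 _] _] jk] := dV S VS nil; apply: leq_trans jk.
  move=> /(linear_free_nilpotent (@leq_up k.+1))[S [VS nil nN]].
  have [j [/nN + _] jk] := dV S VS nil.
  by rewrite ltnNge jk.
rewrite -ltnNge ltnS => nk.
have Sn : `[< nilpotent_with S n.+1 >].
  by apply/asboolP; split=> //; exists z; [have [] := zS|exact: Vn].
have exS : exists j, `[< nilpotent_with S j >] by exists n.+1.
have [j /asboolP Sj minj] := ex_minnP exS.
exists j; last exact: leq_trans (minj _ Sn) nk.
by split=> // i /asboolP; apply: minj.
Qed.

Lemma has_degreeP (V : variety) k : 0 < k ->
  has_degree V k <-> (linear_variety k <= V)%O /\ ~ (linear_variety k.+1 <= V)%O.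
Proof.
move=> k0; split=> [[/degree_boundedP[_ nV] minV]|[FV nV]].
  split=> //; apply: contrapT => nF; case: k k0 nV minV nF => // -[|k] _ nV minV nF.
    exact/nF/linear_variety1_le.
  have /minV : degree_bounded V k.+1 by apply/degree_boundedP.
  by rewrite ltnn.
split; first exact/degree_boundedP.
move=> j /degree_boundedP[j0 nj]; rewrite leqNgt; apply/negP => jk; apply: nj.
exact: le_trans (linear_variety_mono jk) FV.
Qed.

(** * The variety of null semigroups is distributive *)

Definition distributive_element (d : Order.disp_t) (L : latticeType d) (a : L) : Prop :=
  forall x y : L, Order.join a (Order.meet x y) =
                  Order.meet (Order.join a x) (Order.join a y).

(** F_2 is the variety of null semigroups, defined by xy = zt. *)
Lemma theory_null u v :
  theory (linear_variety 2) (u, v) <-> u = v \/ u.2 != [::] /\ v.2 != [::].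
Proof.
rewrite /= theory_models; last exact: linear_theory_fi (@leq_up 2).
have C w : collapsed (leq 2) w = (w.2 != [::]).
  by case: w => i [|j s]; rewrite /collapsed // orbT.
split=> [[uv|[]]|[->|[Cu Cv]]]; rewrite ?C; last 2 first.
- by left.
- by right; rewrite !C.
- case: u uv => i [|j s] uv; last first.
    by right; split=> //; move/perm_size: uv; case: (v) => k [].
  by left; apply/esym/letters_inj/perm_small_eq; rewrite // perm_sym.
- by right.
Qed.

Lemma null_meet_join (X Y : variety) u v :
  theory (linear_variety 2) (u, v) -> theory X (u, v) \/ theory Y (u, v) ->
  theory (Order.meet (Order.join (linear_variety 2) X)
                     (Order.join (linear_variety 2) Y)) (u, v).
Proof.
move=> Zuv [Xuv|Yuv].
  by have /le_theory := leIl (Order.join (linear_variety 2) X)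
    (Order.join (linear_variety 2) Y); apply; rewrite theory_join.
by have /le_theory := leIr (Order.join (linear_variety 2) Y)
  (Order.join (linear_variety 2) X); apply; rewrite theory_join.
Qed.

Definition power_word (i n : nat) : word := (i, nseq n i).

Lemma word_val_const (S : semigroup) (x : S) w :
  word_val (fun=> x) w = power x (size w.2).
Proof.
case: w => i s; rewrite /power !word_val_act /=.
suff H a : word_act (fun=> x) a s = word_act (fun=> x) a (nseq (size s) 0) by exact: H.
by elim: s a => //= j s IHs a.
Qed.

Lemma word_val_power_word (S : semigroup) (f : nat -> S) i n :
  word_val f (power_word i n) = power (f i) n.
Proof.
rewrite /power !word_val_act /=.
suff H a : word_act f a (nseq n i) = word_act (fun=> f i) a (nseq n 0) by exact: H.
by elim: n a => //= n IHn a.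
Qed.

Lemma subst_neq_nil sigma w :
  (forall i, (sigma i).2 != [::]) -> (subst sigma w).2 != [::].
Proof.
move=> long; have := congr1 size (letters_subst sigma w).
case: w => i s; rewrite /= size_cat /=; have := long i.
by case: (sigma i) => j [] //= k t _; case: (subst _ _).2.
Qed.

(** Let u = v, with sides of length at least 2, hold in the meet of X and Y.  It is
    derived by steps from X and from Y, and these may pass through single letters,
    where they are not identities of null semigroups.  Substituting words of length
    at least 2 for the letters, as expressed by the congruence E, avoids this; and
    as X satisfies x = w for a word w that is not a letter, it satisfies some
    x = x^m with 1 < m, so that the substitution of x^m for every letter x does not
    change the values of u and v in X. *)
Lemma null_distributive_aux (X Y : variety) i w : theory X ((i, [::]), w) ->
  w.2 != [::] ->
  theory (linear_variety 2) `&` theory (Order.meet X Y) `<=`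
  theory (Order.meet (Order.join (linear_variety 2) X)
                     (Order.join (linear_variety 2) Y)).
Proof.
move=> Xw w2; set M := Order.meet (Order.join _ _) _.
have fM := theory_fully_invariant M; have fX := theory_fully_invariant X.
have fY := theory_fully_invariant Y.
pose E : set identity := [set u | forall sigma, (forall i, (sigma i).2 != [::]) ->
  theory M (subst sigma u.1, subst sigma u.2)].
have fiE : fully_invariant E.
  split=> [u sigma|u v uv sigma long|v u t uv vt sigma long
    |u v u' v' uv uv' sigma long|tau u v uv sigma long] /=.
  - by move=> _; exact: (fi_refl fM).
  - exact: (fi_sym fM) (uv _ long).
  - exact: (fi_trans fM) (uv _ long) (vt _ long).
  - by rewrite !subst_mul; exact: (fi_mul fM) (uv _ long) (uv' _ long).
  - by rewrite !subst_subst; apply: uv => j; exact: subst_neq_nil.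
have sub : theory (Order.meet X Y) `<=` E.
  apply: theory_meet_sub => // -[u v] uv sigma long; apply: null_meet_join.
  - by apply/theory_null; right; rewrite !subst_neq_nil.
  - by left; exact: (fi_subst fX).
  - by apply/theory_null; right; rewrite !subst_neq_nil.
  - by right; exact: (fi_subst fY).
(* Setting all letters of x = w equal gives x = x^m with m the length of w. *)
pose sigma j := power_word j (size w.2).
have long j : (sigma j).2 != [::] by rewrite /=; case: (w.2) w2.
have Xsigma u : theory X (u, subst sigma u).
  rewrite -{1}(_ : subst (fun j => (j, [::])) u = u); last first.
    by rewrite -(rename_subst id); apply: letters_inj; rewrite letters_rename map_id.
  move=> S XS f; rewrite /= !word_val_subst; apply: eq_in_word_val => j _ /=.
  have := Xw S XS (fun=> f j); rewrite /= /sigma => e.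
  by rewrite [LHS]e !word_val_const word_val_power_word.
move=> [u v] [Zuv /sub/(_ _ long)/= Muv].
have step t : t.2 != [::] -> theory M (t, subst sigma t).
  move=> t2; apply: null_meet_join; last by left.
  by apply/theory_null; right; rewrite subst_neq_nil.
have /theory_null[->|[u2 v2]] := Zuv; first exact: (fi_refl fM).
exact: (fi_trans fM (step _ u2)) (fi_trans fM Muv (fi_sym fM (step _ v2))).
Qed.

(** A variety without nontrivial null semigroups satisfies some x = w with w of
    length at least 2. *)
Lemma null_le_or_letter (Z : variety) :
  (linear_variety 2 <= Z)%O \/ exists i w, theory Z ((i, [::]), w) /\ w.2 != [::].
Proof.
have [?|NZ] := pselect (linear_variety 2 <= Z)%O; [by left|right].
have fZ := theory_fully_invariant Z.
have [u [v [Zuv Nuv]]] : exists u v, theory Z (u, v) /\ ~ theory (linear_variety 2) (u, v).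
  apply: contra_notP NZ => H; apply/le_theory => -[u v] Zuv.
  by apply: contrapT => Nuv; apply: H; exists u, v.
have key i w : theory Z ((i, [::]), w) -> w <> (i, [::]) ->
    exists i w, theory Z ((i, [::]), w) /\ w.2 != [::].
  case: w => j [|k s] Zw ij; last by exists i, (j, k :: s).
  exists i, (i, [:: i]); split=> //.
  have /(fi_subst fZ (fun k => if k == j then (i, [:: i]) else (i, [::]))) := Zw.
  rewrite /subst /word_val /= eqxx; case: eqP => // e.
  by case: ij; rewrite e.
case: u Zuv Nuv => i [|k s] Zuv Nuv.
  by apply: key Zuv _ => vE; apply/Nuv/theory_null; left.
case: v Zuv Nuv => j [|k' s'] Zuv Nuv.
  by apply: key (fi_sym fZ Zuv) _.
by case: Nuv; apply/theory_null; right.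
Qed.

Lemma null_distributive : distributive_element (linear_variety 2).
Proof.
move=> X Y; apply/le_anti/andP; split.
  by rewrite leUx !lexI !leUl /= !(le_trans _ (leUr _ _)) ?leIl ?leIr.
have [ZX|[i [w [Xw w2]]]] := null_le_or_letter X; last first.
  by apply/le_theory; rewrite theory_join; exact: null_distributive_aux Xw w2.
have [ZY|[i [w [Yw w2]]]] := null_le_or_letter Y; last first.
  apply/le_theory; rewrite theory_join (meetC X) (meetC (Order.join _ X)).
  exact: null_distributive_aux Yw w2.
by rewrite (join_idPr ZX) (join_idPr ZY) leUr.
Qed.

(** * Atoms that are not distributive *)

(** The two words xyxx and xxyx have the same first letter, the same last letter
    and the same number of occurrences of each letter; in all these respects yxxy
    differs from them, the numbers of occurrences differing by one. *)
Definition xyxx (i j : nat) : word := (i, [:: j; i; i]).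
Definition xxyx (i j : nat) : word := (i, [:: i; j; i]).
Definition yxxy (i j : nat) : word := (j, [:: i; i; j]).

Section Swap.
Variable pat : nat -> nat -> word.
Hypothesis patE : pat = xyxx \/ pat = xxyx.

(** The theory of semigroups with x_1 ... x_5 = 0 in which the pattern takes the
    same values as yxxy.  No consequence other than these occurs among words of
    length 4, because a substitution that is not a renaming lengthens the words. *)
Definition swap_theory : set identity :=
  [set u | [\/ u.1 = u.2, 4 < size (letters u.1) /\ 4 < size (letters u.2) |
    exists i j, u = (pat i j, yxxy i j) \/ u = (yxxy i j, pat i j)]].

Lemma swap_size u v : swap_theory (u, v) ->
  u = v \/ 3 < size (letters u) /\ 3 < size (letters v).
Proof.
case=> [|[/ltnW ? /ltnW ?]|[i [j [] [-> ->]]]]; [by left|by right|right|right].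
  by case: patE => ->.
by case: patE => ->.
Qed.

Lemma pat_inj i j i' j' : pat i j = pat i' j' -> i = i' /\ j = j'.
Proof. by case: patE => -> []. Qed.

Lemma pat_yxxy i j i' j' : yxxy i j = pat i' j' -> [/\ i = j, i' = j & j' = j].
Proof. by case: patE => -> [*]; subst. Qed.

Lemma swap_theory_fi : fully_invariant swap_theory.
Proof.
split=> [u|u v|v u w|u v u' v'|sigma u v].
- by constructor 1.
- case=> [/= ->|[? ?]|[i [j H]]]; [by constructor 1|by constructor 2|constructor 3].
  by exists i, j; case: H => [] [-> ->]; [right|left].
- case=> [/= ->//|[/= u4 v4]|[i [j uv]]].
    case=> [/= <-|[/= _ w4]|[i [j [] [vE _]]]]; [by constructor 2|by constructor 2| |].
      by move: v4; rewrite vE; case: patE => ->.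
    by move: v4; rewrite vE.
  case=> [/= <-|[/= v4 _]|[i' [j' vw]]]; first by constructor 3; exists i, j.
    by move: v4; case: uv => [] [_ ->] //; case: patE => ->.
  case: uv => [] [-> vE]; case: vw => [] [wE ->]; constructor 1; move: wE; rewrite vE.
  + by move/pat_yxxy => [-> -> ->]; case: patE => ->.
  + by case=> -> ->.
  + by move/pat_inj => [-> ->].
  + by move/esym/pat_yxxy => [-> -> ->]; case: patE => ->.
- move=> /swap_size[->|[u4 v4]] /swap_size[->|[u4' v4']].
  + by constructor 1.
  + constructor 2; rewrite !letters_mul !size_cat /= !addSn !ltnS.
    by split; apply: leq_trans (leq_addl _ _).
  + constructor 2; rewrite !letters_mul !size_cat /= !addnS !ltnS.
    by split; apply: leq_trans (leq_addr _ _).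
  + constructor 2; rewrite !letters_mul !size_cat /= !addnS !ltnS.
    by split; apply: leq_trans (leq_addr _ _).
- have sizeS w : size (letters w) <= size (letters (subst sigma w)).
    rewrite letters_subst.
    by elim: (letters w) => //= i s IHs; rewrite size_cat ltnS (leq_trans IHs) ?leq_addl.
  case=> [/= ->|[/= u4 v4]|[i [j H]]]; first by constructor 1.
    by constructor 2; split; [exact: leq_trans (sizeS u)|exact: leq_trans (sizeS v)].
  have [sij|] := boolP ((size (sigma i).2 == 0) && (size (sigma j).2 == 0)).
    case/andP: sij; case ei: (sigma i) => [i' [|//]] _; case ej: (sigma j) => [j' [|//]] _.
    constructor 3; exists i', j'.
    case: H patE => [] [-> ->] [] ->; rewrite /subst /word_val /= ei ej;
      by [left|right].
  move=> ij.
  have long w : w = pat i j \/ w = yxxy i j -> 4 < size (letters (subst sigma w)).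
    rewrite letters_subst; case=> ->; [case: patE => ->|];
      rewrite /= !size_cat /= ?cats0;
      case: (sigma i) (sigma j) ij => i' [|? s] [j' [|? t]] //= _;
      by rewrite ?size_cat /= ?(addnS, addSn).
  by constructor 2; case: H => [] [-> ->]; split; apply: long; auto.
Qed.

End Swap.

(** Let X and Y satisfy respectively xyxx = yxxy and xxyx = yxxy in length 4.  Their
    meet satisfies xyxx = xxyx, hence so does its join with a.  But neither of the
    two defining identities holds in a, so the join of a with X contains Y and the
    join of a with Y contains X: the meet of these joins contains X, in which
    xyxx = xxyx fails. *)
Lemma not_distributive (a : variety) :
  theory a (xyxx 0 1, xxyx 0 1) ->
  (forall i j, theory a (xyxx i j, yxxy i j) -> i = j) ->
  ~ distributive_element a.
Proof.
move=> a1 a2 Da; have fa := theory_fully_invariant a.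
have a1' i j : theory a (xyxx i j, xxyx i j).
  exact: (fi_subst fa (fun k => if k is 0 then (i, [::]) else (j, [::])) a1).
have fX : fully_invariant (swap_theory xyxx) by apply: swap_theory_fi; left.
have fY : fully_invariant (swap_theory xxyx) by apply: swap_theory_fi; right.
pose X := defined_by (swap_theory xyxx); pose Y := defined_by (swap_theory xxyx).
have YaX : (Y <= Order.join a X)%O.
  apply/le_theory; rewrite theory_join !theory_models // => -[u v] [auv].
  case=> [uv|uv|[i [j uv]]]; [by constructor 1|by constructor 2|].
  have ij : i = j.
    by apply: a2; case: uv auv => [] [-> ->] // auv; exact: (fi_sym fa auv).
  by constructor 1; case: uv => [] [-> ->]; rewrite ij.
have XaY : (X <= Order.join a Y)%O.
  apply/le_theory; rewrite theory_join !theory_models // => -[u v] [auv].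
  case=> [uv|uv|[i [j uv]]]; [by constructor 1|by constructor 2|].
  have ij : i = j.
    apply: a2; apply: (fi_trans fa (a1' i j)).
    by case: uv auv => [] [-> ->] // auv; exact: (fi_sym fa auv).
  by constructor 1; case: uv => [] [-> ->]; rewrite ij.
have : (X <= Order.join a (Order.meet X Y))%O by rewrite Da lexI leUr.
move=> /le_theory; rewrite theory_join [theory X]theory_models //.
move=> /(_ (xyxx 0 1, xxyx 0 1)) [].
- have fM := theory_fully_invariant (Order.meet X Y).
  have XM : (Order.meet X Y <= X)%O by exact: leIl.
  have YM : (Order.meet X Y <= Y)%O by exact: leIr.
  split=> //; apply: (@fi_trans _ fM (yxxy 0 1)).
    by move/le_defined_by: XM; apply; constructor 3; exists 0, 1; left.
  by move/le_defined_by: YM; apply; constructor 3; exists 0, 1; right.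
- by [].
- by case.
(* The pairs of the theory whose sides have length 4 contain yxxy. *)
- case=> i [j [] e].
    have j1 : j = 1 by have := congr1 (fun w => head 0 w.1.2) e.
    by have := congr1 (fun w => w.2.1) e; rewrite /= j1.
  have i1 : i = 1 by have := congr1 (fun w => head 0 w.1.2) e.
  by have := congr1 (fun w => nth 0 w.1.2 1) e; rewrite /= i1.
Qed.

Lemma trivial_variety (W : variety) :
  (forall (S : semigroup) (x y : S), variety_class W S -> x = y) -> W = linear_variety 1.
Proof.
move=> H; apply/le_anti; rewrite linear_variety1_le andbT; apply/le_defined_by => u _ S WS f.
exact: H.
Qed.

Definition generated (S : semigroup) : variety := defined_by (theory [set S]).

Lemma le_generated (V : variety) (S : semigroup) u v : (V <= generated S)%O ->
  satisfies S (u, v) -> theory V (u, v).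
Proof. by move=> /le_defined_by VS uv; apply: VS => _ ->. Qed.

Lemma not_generated_le (S : semigroup) (V : variety) : ~ (generated S <= V)%O ->
  exists u v (f : nat -> S), theory V (u, v) /\ word_val f u <> word_val f v.
Proof.
move=> /(not_defined_by_le (theory_fully_invariant _))[u [v [Vuv nuv]]].
exists u, v; apply: contra_notP nuv => H _ -> f /=.
by apply: contrapT => nf; apply: H; exists f.
Qed.

(** The second hypothesis says that xyxx = yxxy can be cancelled down to x = y. *)
Lemma not_distributive_generated (S : semigroup) (a : variety) :
  satisfies S (xyxx 0 1, xxyx 0 1) ->
  (forall (V : variety) i j, (V <= generated S)%O ->
    theory V (xyxx i j, yxxy i j) -> theory V ((i, [::]), (j, [::]))) ->
  (a <= generated S)%O -> a <> linear_variety 1 -> ~ distributive_element a.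
Proof.
move=> S1 S2 aS na; apply: not_distributive; first exact: le_generated aS S1.
move=> i j /(S2 _ _ _ aS) aij; apply/eqP; apply: contra_notT na => ij.
apply: trivial_variety => T x y /aij /(_ (fun k => if k == i then x else y)).
by rewrite /word_val /= eqxx eq_sym (negbTE ij).
Qed.

Lemma left_zero_mulA : associative (fun x _ : bool => x). Proof. by []. Qed.
Lemma right_zero_mulA : associative (fun _ y : bool => y). Proof. by []. Qed.

Definition left_zero_band : semigroup :=
  @Defs.Semigroup bool _ left_zero_mulA (inhabits true).
Definition right_zero_band : semigroup :=
  @Defs.Semigroup bool _ right_zero_mulA (inhabits true).
Definition semilattice : semigroup := @Defs.Semigroup bool _ andbA (inhabits true).

(** The cyclic group has order p+1. *)
Section CyclicGroup.
Variable p : nat.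

Definition residue := {m : nat | m < p.+1}.

Definition residue_add (x y : residue) : residue :=
  exist _ ((val x + val y) %% p.+1) (ltn_pmod (val x + val y) (ltn0Sn p)).

Lemma residue_addA : associative residue_add.
Proof. by move=> x y z; apply: val_inj; rewrite /= modnDml modnDmr addnA. Qed.

Definition cyclic_group : semigroup :=
  @Defs.Semigroup residue _ residue_addA (inhabits (exist _ 0 (ltn0Sn p))).

Lemma cyclic_word_val (f : nat -> cyclic_group) w :
  val (word_val f w) = (\sum_(i <- letters w) val (f i)) %% p.+1.
Proof.
case: w => i s; elim/last_ind: s => [|s j IHs].
  by rewrite /word_val /= big_seq1 modn_small // (valP (f i)).
rewrite -cats1 -[(i, s ++ _)]/(word_mul (i, s) (j, [::])) word_val_mul.
by rewrite letters_mul big_cat big_seq1 /= IHs modnDml.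
Qed.

Lemma cyclic_identity u v :
  (forall f : nat -> nat,
    \sum_(i <- letters u) f i = \sum_(i <- letters v) f i %[mod p.+1]) ->
  satisfies cyclic_group (u, v).
Proof. by move=> uv f; apply: val_inj; rewrite /= !cyclic_word_val. Qed.

End CyclicGroup.

Lemma left_zero_not_distributive (a : variety) : (a <= generated left_zero_band)%O ->
  a <> linear_variety 1 -> ~ distributive_element a.
Proof.
apply: not_distributive_generated => // V i j VL Vij.
have fV := theory_fully_invariant V.
have Vi : theory V (xyxx i j, (i, [::])) by apply: le_generated VL _ => f.
have Vj : theory V (yxxy i j, (j, [::])) by apply: le_generated VL _ => f.
exact: (fi_trans fV (fi_sym fV Vi) (fi_trans fV Vij Vj)).
Qed.

Lemma right_zero_not_distributive (a : variety) : (a <= generated right_zero_band)%O ->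
  a <> linear_variety 1 -> ~ distributive_element a.
Proof.
apply: not_distributive_generated => // V i j VR Vij.
have fV := theory_fully_invariant V.
have Vi : theory V (xyxx i j, (i, [::])) by apply: le_generated VR _ => f.
have Vj : theory V (yxxy i j, (j, [::])) by apply: le_generated VR _ => f.
exact: (fi_trans fV (fi_sym fV Vi) (fi_trans fV Vij Vj)).
Qed.

Lemma sum_letters_subst (f : nat -> nat) sigma w :
  \sum_(k <- letters (subst sigma w)) f k =
  \sum_(i <- letters w) \sum_(k <- letters (sigma i)) f k.
Proof. by rewrite letters_subst big_flatten big_map. Qed.

(** With w = xxy and q = p+1 the order of the group, xyxx and yxxy are up to
    commutation x w and y w; multiplying by w^(q-1) cancels w. *)
Lemma cyclic_not_distributive p (a : variety) : 0 < p ->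
  (a <= generated (cyclic_group p))%O ->
  a <> linear_variety 1 -> ~ distributive_element a.
Proof.
move=> p0; apply: not_distributive_generated => [|V i j VC Vij].
  by apply: cyclic_identity => f; rewrite !big_cons !big_nil /= [f 1 + _]addnCA.
have fV := theory_fully_invariant V.
pose t : word := subst (fun=> (i, [:: i; j])) (0, nseq p.-1 0).
have sum_t f : \sum_(k <- letters t) f k = p * (f i + f i + f j).
  rewrite sum_letters_subst (_ : letters (0, _) = nseq p 0); last first.
    by rewrite -{2}(prednK p0).
  rewrite big_const_seq count_predT size_nseq iter_addn_0 !big_cons big_nil.
  by rewrite addn0 mulnC addnA.
have Vi : theory V (word_mul (xyxx i j) t, (i, [::])).
  apply: le_generated VC _; apply: cyclic_identity => f.
  rewrite letters_mul big_cat sum_t !big_cons !big_nil /= !addn0.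
  rewrite (_ : _ + _ = (f i + f i + f j) * p.+1 + f i) ?modnMDl //.
  by rewrite mulnS; lia.
have Vj : theory V (word_mul (yxxy i j) t, (j, [::])).
  apply: le_generated VC _; apply: cyclic_identity => f.
  rewrite letters_mul big_cat sum_t !big_cons !big_nil /= !addn0.
  rewrite (_ : _ + _ = (f i + f i + f j) * p.+1 + f j) ?modnMDl //.
  by rewrite mulnS; lia.
have Vij' := fi_mul fV Vij (fi_refl fV t).
exact: (fi_trans fV (fi_sym fV Vi) (fi_trans fV Vij' Vj)).
Qed.

(** * Aperiodicity *)

(** The identity x^(a+1) = x^(b+1), in view of the shift in [power]. *)
Definition power_identity (V : variety) (a b : nat) : Prop :=
  forall S : semigroup, variety_class V S -> forall x : S, power x a = power x b.

Lemma power_identityD V a b c :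
  power_identity V a b -> power_identity V (a + c) (b + c).
Proof.
move=> ab S VS x; elim: c => [|c IHc]; first by rewrite !addn0; exact: ab.
by rewrite !addnS !powerSr IHc.
Qed.

Lemma power_identityM V a b q :
  power_identity V a (a + b) -> power_identity V a (a + q * b).
Proof.
move=> ab; elim: q => [|q IHq] S VS x; first by rewrite addn0.
by rewrite mulSn addnA (IHq S VS) (@power_identityD _ _ _ (q * b) ab).
Qed.

(** An identity failing in the group fails for some residues f i; substituting
    for each letter i a power of x with exponent congruent to f i turns it into an
    identity between powers of x. *)
Lemma cyclic_power_identity (V : variety) p : ~ (generated (cyclic_group p) <= V)%O ->
  exists a b, power_identity V a b /\ a <> b %[mod p.+1].
Proof.
move=> /not_generated_le[u [v [f [Vuv nuv]]]].
(* The summand p makes up for the shift of exponents modulo p+1. *)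
pose sigma i := power_word 0 (p + val (f i)).
have size_sigma w :
    (size (subst sigma w).2).+1 = \sum_(i <- letters w) val (f i) %[mod p.+1].
  rewrite -[_.+1]/(size (letters (subst sigma w))) -sum1_size sum_letters_subst.
  elim: (letters w) => [|i s IHs]; first by rewrite !big_nil.
  rewrite !big_cons -modnDmr IHs modnDmr sum1_size /= size_nseq.
  by rewrite addnA add1n -addnA modnDl.
exists (size (subst sigma u).2), (size (subst sigma v).2); split.
  move=> S VS x; rewrite -!(@word_val_const S x).
  exact: (fi_subst (theory_fully_invariant V) sigma Vuv) S VS (fun=> x).
move=> e; apply: nuv; apply: val_inj; rewrite !cyclic_word_val -!size_sigma.
by rewrite -[in LHS]addn1 -[in RHS]addn1 -modnDml e modnDml.
Qed.

(** The least possible period d of the powers is 1: otherwise some period e is not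
    divisible by a given prime divisor of d, and e mod d is a smaller positive
    period. *)
Lemma aperiodic (V : variety) :
  (forall p, 0 < p -> ~ (generated (cyclic_group p) <= V)%O) ->
  exists n, power_identity V n n.+1.
Proof.
move=> nC.
have cyc p : 1 < p -> exists a e, power_identity V a (a + e) /\ ~~ (p %| e).
  case: p => [|[|p]] // _.
  have [//|a [b [ab nab]]] := @cyclic_power_identity V p.+1 (nC p.+1 _).
  wlog le_ab : a b ab nab / a <= b.
    move=> H; case/orP: (leq_total a b) => [/H|]; first exact.
    by move=> /H; apply=> [S VS x|]; [rewrite ab|move/esym].
  exists a, (b - a); rewrite subnKC //; split=> //.
  by rewrite -eqn_mod_dvd //; apply/eqP => e; apply: nab.
pose good d := `[< 0 < d /\ exists i, power_identity V i (i + d) >].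
have ex_good : exists d, good d.
  have [a [e [ae e2]]] := cyc 2 isT; exists e; apply/asboolP; split; last by exists a.
  by case: e e2 {ae}.
have [d /asboolP[d0 [i id]] mind] := ex_minnP ex_good.
have [d1|d1] := leqP d 1.
  by exists i; rewrite -addn1 (_ : 1 = d) //; apply/eqP; rewrite eqn_leq d0 d1.
have [a [e [ae pe]]] := cyc _ (prime_gt1 (pdiv_prime d1)).
have r0 : 0 < e %% d.
  rewrite lt0n; apply: contra pe => /eqP ed.
  by apply: dvdn_trans (pdiv_dvd d) _; apply/eqP.
suff /mind : good (e %% d) by rewrite leqNgt ltn_pmod.
apply/asboolP; split=> //; exists (i + a) => S VS x.
have je : power_identity V (i + a) (i + a + e).
  by rewrite addnC -addnA [i + e]addnC addnA; apply: power_identityD.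
rewrite (je S VS) {1}(divn_eq e d) addnA (addnC _ (e %% d)) addnA.
have := power_identityM (e %/ d) id; move=> /(@power_identityD _ _ _ (a + e %% d)) id'.
have := id' S VS x; rewrite !addnA => ->; congr (power x _); lia.
Qed.

(** * Varieties without small semigroups *)

(** An identity of V failing in B maps to an equality in S.  With B of two elements
    this identifies pairs of elements of S that form a copy of B. *)
Lemma morphism_collapse (B : semigroup) (V : variety) (S : semigroup) (h : B -> S) :
  ~ (generated B <= V)%O -> variety_class V S -> morphism h ->
  exists x y, x <> y /\ h x = h y.
Proof.
move=> /not_generated_le[u [v [f [Vuv nuv]]]] VS hM.
exists (word_val f u), (word_val f v); split=> //.
by rewrite !(morphism_word_val _ _ hM); apply: Vuv.
Qed.

Section NoSmallVarieties.
Variable V : variety.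
Hypothesis noL : ~ (generated left_zero_band <= V)%O.
Hypothesis noR : ~ (generated right_zero_band <= V)%O.

Lemma left_zero_pair (S : semigroup) (x y : S) : variety_class V S ->
  x ** x = x -> y ** y = y -> x ** y = x -> y ** x = y -> x = y.
Proof.
move=> VS xx yy xy yx.
have := @morphism_collapse left_zero_band V S
  (fun b : bool => if b then x else y) noL VS.
by case=> [[] []|[] [[] []]] //; case.
Qed.

Lemma right_zero_pair (S : semigroup) (x y : S) : variety_class V S ->
  x ** x = x -> y ** y = y -> x ** y = y -> y ** x = x -> x = y.
Proof.
move=> VS xx yy xy yx.
have := @morphism_collapse right_zero_band V S
  (fun b : bool => if b then x else y) noR VS.
by case=> [[] []|[] [[] []]] //; case.
Qed.

Lemma semilattice_pair (S : semigroup) (x y : S) :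
  ~ (generated semilattice <= V)%O -> variety_class V S ->
  x ** x = x -> y ** y = y -> x ** y = y -> y ** x = y -> x = y.
Proof.
move=> noS VS xx yy xy yx.
have := @morphism_collapse semilattice V S (fun b : bool => if b then x else y) noS VS.
by case=> [[] []|[] [[] []]] //; case.
Qed.

Lemma power_left (S : semigroup) (x t : S) n : x ** t = t -> x ** power t n = power t n.
Proof. by case: n => [//|n] xt; rewrite powerS sg_mulA xt. Qed.

Lemma power_right (S : semigroup) (x t : S) n : t ** x = t -> power t n ** x = power t n.
Proof. by case: n => [//|n] xt; rewrite powerSr -sg_mulA xt. Qed.

Lemma power_idem n (S : semigroup) (x : S) : power_identity V n n.+1 ->
  variety_class V S -> power x n ** power x n = power x n.
Proof.
rewrite -addn1 => Vn VS; rewrite powerD -addnS.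
by have := power_identityM n.+1 Vn; rewrite muln1 => /(_ S VS x) <-.
Qed.

(** Here x^(n+1) is idempotent for every x.  Two idempotents e and f satisfy
    e = (efe)^(n+1), as these two form a semilattice; so h = (ef)^(n+1) forms with e
    a right zero band and with f a left zero band, whence e = h = f.  The unique
    idempotent is a zero. *)
Lemma nil_of_no_small_varieties n : ~ (generated semilattice <= V)%O ->
  power_identity V n n.+1 ->
  forall S : semigroup, variety_class V S ->
  exists z : S, is_zero z /\ forall x : S, power x n = z.
Proof.
move=> noS Vn S VS.
have idem x : power x n ** power x n = power x n := power_idem x Vn VS.
have below (e f : S) : e ** e = e -> power (e ** f ** e) n = e.
  move=> ee; symmetry; apply: (semilattice_pair noS VS ee (idem _)).
    by apply: power_left; rewrite !sg_mulA ee.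
  by apply: power_right; rewrite -!sg_mulA ee.
have eq_idem (e f : S) : e ** e = e -> f ** f = f -> e = f.
  move=> ee ff; pose h := power (e ** f) n.
  have eh : e ** h = h by apply: power_left; rewrite sg_mulA ee.
  have hf : h ** f = h by apply: power_right; rewrite -sg_mulA ff.
  have he : h ** e = e.
    rewrite -{2}(below e f ee) /h; elim: (n) => [//|m IHm].
    by rewrite !powerS -IHm -!sg_mulA (sg_mulA e (power _ _)) power_left // sg_mulA ee.
  have fh : f ** h = f.
    rewrite -{2}(below f e ff) /h; elim: (n) => [|m IHm]; first by rewrite sg_mulA.
    by rewrite !powerS -IHm -!sg_mulA (sg_mulA f f) ff.
  have -> : e = h by exact: (right_zero_pair VS ee (idem _) eh he).
  by symmetry; exact: (left_zero_pair VS ff (idem _) fh hf).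
have [x0] := sg_inhabited S; exists (power x0 n).
have powE x : power x n = power x0 n by apply: eq_idem.
split=> // y; rewrite -(powE y); split.
  by rewrite -powerSr -Vn.
by rewrite -powerS -Vn.
Qed.

(** In a band xy and xyx form a right zero band, and yx and xyx a left zero band. *)
Lemma band_commutative (S : semigroup) : variety_class V S ->
  (forall x : S, x ** x = x) -> commutative (@sg_mul S).
Proof.
move=> VS band x y.
have -> : x ** y = x ** y ** x.
  have xb : x ** (x ** y) = x ** y by rewrite sg_mulA band.
  apply: right_zero_pair; rewrite ?band //; first by rewrite sg_mulA band.
  by rewrite -sg_mulA xb band.
have cx : y ** x ** x = y ** x by rewrite -sg_mulA band.
symmetry; rewrite -sg_mulA; apply: left_zero_pair; rewrite ?band //.
  by rewrite sg_mulA cx band.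
by rewrite -sg_mulA band.
Qed.

End NoSmallVarieties.

(** Evaluating at the valuations that are false at a single letter shows that u and
    v have the same letters; in a semilattice each of their values then absorbs the
    other one. *)
Lemma semilattice_identity (S : semigroup) u v :
  (forall x : S, x ** x = x) -> commutative (@sg_mul S) ->
  satisfies semilattice (u, v) -> satisfies S (u, v).
Proof.
move=> band comm uv f.
have absorb w i : i \in letters w -> word_val f w ** f i = word_val f w.
  case: w => k s; elim/last_ind: s => [|s j IHs].
    by rewrite inE => /eqP->; exact: band.
  rewrite -cats1 -[(k, s ++ _)]/(word_mul (k, s) (j, [::])) word_val_mul.
  rewrite letters_mul mem_cat.
  case/orP=> [/IHs ki|]; last by rewrite inE => /eqP->; rewrite -sg_mulA band.
  by rewrite -sg_mulA (comm _ (f i)) sg_mulA ki.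
have sl (g : nat -> semilattice) w : word_val g w = all g (letters w).
  case: w => k s; elim/last_ind: s => [|s j IHs]; first by rewrite /= andbT.
  rewrite -cats1 -[(k, s ++ _)]/(word_mul (k, s) (j, [::])) word_val_mul.
  by rewrite letters_mul all_cat IHs /= andbT.
have content i : (i \in letters u) = (i \in letters v).
  have := uv (predC (pred1 i) : nat -> semilattice).
  by rewrite /= !sl !all_predC !has_pred1 => /negb_inj.
have absorbs w w' : {subset letters w' <= letters w} ->
    word_val f w ** word_val f w' = word_val f w.
  rewrite -word_act_letters; elim: (letters w') => //= i s IHs sub.
  rewrite absorb ?sub ?mem_head // IHs // => j sj; apply: sub.
  by rewrite inE sj orbT.
have uE : word_val f u ** word_val f v = word_val f u.
  by apply: absorbs => i; rewrite content.
have vE : word_val f v ** word_val f u = word_val f v.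
  by apply: absorbs => i; rewrite content.
by rewrite /= -uE comm vE.
Qed.

(** * Nilpotent varieties have coatoms *)

Definition coatomless (d : Order.disp_t) (L : latticeType d) (x : L) : Prop :=
  forall y : L, (y < x)%O -> exists z : L, (y < z)%O /\ (z < x)%O.

(** All words of length at least k have the same value in U.  A subvariety of U is
    then determined by its identities between words of bounded length over
    boundedly many letters, which are finite in number. *)
Section Nilpotent.
Variables (U : variety) (k : nat).
Hypothesis nilU : forall w w', k <= size (letters w) -> k <= size (letters w') ->
  theory U (w, w').

(* Two truncated words have at most k+1 letters each. *)
Let M := (k + k).+2.
Let short_word : finType := ('I_M * {bseq M of 'I_M})%type.

Definition decode (t : short_word) : word := (val t.1, map val t.2).

Lemma decode_surj w : all (fun i => i < M) (letters w) -> size w.2 <= M ->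
  exists t, decode t = w.
Proof.
case: w => i s /= /andP[iM sM] ss.
have bs : size (map (@inord (k + k).+1) s) <= M by rewrite size_map.
exists (inord i, Bseq bs); congr (_, _); first exact: inordK.
rewrite /= -map_comp -[RHS]map_id; apply/eq_in_map => j /(allP sM) jM.
exact: inordK.
Qed.

Definition short_identities (W : variety) : {set short_word * short_word} :=
  [set p | `[< theory W (decode p.1, decode p.2) >]].

Definition truncate (w : word) : word :=
  if k <= size (letters w) then (0, nseq k 0) else w.

Lemma truncate_theory w : theory U (w, truncate w).
Proof.
rewrite /truncate; case: ifP => [kw|_]; last exact: (fi_refl (theory_fully_invariant U)).
by apply: nilU => //=; rewrite size_nseq.
Qed.

Lemma size_truncate w : size (letters (truncate w)) <= k.+1.
Proof.
rewrite /truncate; case: ifP => [_|/negbT]; first by rewrite /= size_nseq.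
by rewrite -ltnNge => /ltnW/leqW.
Qed.

(** An identity separating W from W' stays so when its long sides are replaced by
    x_0^(k+1), and when its letters are renamed injectively to the numbers below
    M. *)
Lemma short_identities_proper (W W' : variety) : (W' <= U)%O -> (W < W')%O ->
  #|short_identities W'| < #|short_identities W|.
Proof.
move=> W'U WW'; have WU : (W <= U)%O by apply: le_trans (ltW WW') W'U.
have fW := theory_fully_invariant W; have fW' := theory_fully_invariant W'.
have subW u : theory U u -> theory W u by move/le_theory: WU; apply.
have subW' u : theory U u -> theory W' u by move/le_theory: W'U; apply.
have [u [v [Wuv W'uv]]] : exists u v, theory W (u, v) /\ ~ theory W' (u, v).
  have : ~ (W' <= W)%O by rewrite lt_geF.
  apply: contra_notP => H; apply/le_theory => -[u v] Wuv.
  by apply: contrapT => W'uv; apply: H; exists u, v.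
apply: proper_card; apply/fintype.properP; split.
  apply/fintype.subsetP => p; rewrite !finset.in_set => /asboolP Wp; apply/asboolP.
  by have /le_theory/(_ _ Wp) := ltW WW'.
set u' := truncate u; set v' := truncate v.
have W1 : theory W (u', v').
  apply: (fi_trans fW (fi_sym fW (subW _ (truncate_theory u)))).
  exact: (fi_trans fW Wuv (subW _ (truncate_theory v))).
have W'1 : ~ theory W' (u', v').
  move=> e; apply: W'uv; apply: (fi_trans fW' (subW' _ (truncate_theory u))).
  exact: (fi_trans fW' e (fi_sym fW' (subW' _ (truncate_theory v)))).
pose s := letters u' ++ letters v'; pose r i := index i s.
have sM : size s <= M.
  by rewrite size_cat /M -addnS -addSn leq_add ?size_truncate.
have short w : size (letters w) <= k.+1 -> {subset letters w <= s} ->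
    exists t, decode t = rename r w.
  move=> wk ws; apply: decode_surj.
    rewrite letters_rename all_map; apply/allP => i /ws si /=.
    by rewrite (leq_trans _ sM) // index_mem.
  rewrite /= size_map -ltnS (leq_trans wk) // /M; lia.
have [tu tuE] : exists t, decode t = rename r u'.
  by apply: short => [|i]; rewrite ?size_truncate // mem_cat => ->.
have [tv tvE] : exists t, decode t = rename r v'.
  by apply: short => [|i]; rewrite ?size_truncate // mem_cat orbC => ->.
exists (tu, tv); rewrite finset.in_set /= tuE tvE.
  by apply/asboolP; rewrite !rename_subst; exact: (fi_subst fW).
apply/asboolP => e; apply: W'1.
have back w : {subset letters w <= s} ->
    subst (fun i => (nth 0 s i, [::])) (rename r w) = w.
  move=> ws; rewrite -rename_subst; apply: letters_inj; rewrite !letters_rename.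
  rewrite -map_comp -[RHS]map_id; apply/eq_in_map => i /ws si.
  by rewrite /= nth_index.
have := fi_subst fW' (fun i => (nth 0 s i, [::])) e.
by rewrite !back // => i; rewrite mem_cat => ->; rewrite ?orbT.
Qed.

(** Without coatoms every proper subvariety of U would lie strictly below another
    one, with fewer short identities. *)
Lemma nilpotent_coatomless : coatomless U -> U = linear_variety 1.
Proof.
move=> cU; apply/eqP; apply: contrapT => /negP U1.
have : (linear_variety 1 < U)%O by rewrite lt_neqAle eq_sym U1 linear_variety1_le.
suff H n W : #|short_identities W| < n -> ~ (W < U)%O by apply: H (ltnSn _).
elim: n W => // n IHn W Wn /cU[W' [WW' W'U]].
apply: (IHn W' _ W'U).
exact: leq_trans (short_identities_proper (ltW W'U) WW') Wn.
Qed.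

End Nilpotent.

(** * Definability *)

Section LatticeProperties.
Context {d : Order.disp_t} {L : latticeType d}.

Definition bottom (x : L) : Prop := forall y : L, (x <= y)%O.

(** The condition on a makes it the least nontrivial subvariety; the intended a is
    the variety of null semigroups. *)
Definition null_limit (x : L) : Prop :=
  coatomless x /\
  exists a : L, [/\ (a <= x)%O, ~ bottom a, distributive_element a &
    forall y : L, (y <= x)%O -> ~ bottom y -> (a <= y)%O].

Fixpoint has_chain (k : nat) (x : L) : Prop :=
  if k is k'.+1 then exists y : L, (y < x)%O /\ has_chain k' y else True.

(** The index arguments of the formulas below are those of the de Bruijn variables
    that they speak of. *)
Definition le_formula (s t : term) : formula := Eq (Meet s t) s.
Definition lt_formula (s t : term) : formula := And (le_formula s t) (Not (Eq s t)).

Definition bottom_formula (i : nat) : formula :=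
  Forall (le_formula (Var i.+1) (Var 0)).

Definition distributive_formula (i : nat) : formula :=
  Forall (Forall (Eq (Join (Var i.+2) (Meet (Var 1) (Var 0)))
    (Meet (Join (Var i.+2) (Var 1)) (Join (Var i.+2) (Var 0))))).

Definition coatomless_formula (i : nat) : formula :=
  Forall (Defs.Implies (lt_formula (Var 0) (Var i.+1))
    (Exists (And (lt_formula (Var 1) (Var 0)) (lt_formula (Var 0) (Var i.+2))))).

Definition null_limit_formula (i : nat) : formula :=
  And (coatomless_formula i)
    (Exists (And (And (le_formula (Var 0) (Var i.+1)) (Not (bottom_formula 0)))
      (And (distributive_formula 0)
        (Forall (Defs.Implies (le_formula (Var 0) (Var i.+2))
          (Defs.Implies (Not (bottom_formula 0)) (le_formula (Var 1) (Var 0)))))))).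

Fixpoint chain_formula (k : nat) : formula :=
  if k is k'.+1 then Exists (And (lt_formula (Var 0) (Var 1)) (chain_formula k'))
  else Eq (Var 0) (Var 0).

Lemma chain_formula_closed k n : formula_closed n.+1 (chain_formula k).
Proof. by elim: k n => //= k IHk n; rewrite IHk. Qed.

Implicit Types e : nat -> L.

Lemma meet_leP (x y : L) : Order.meet x y = x <-> (x <= y)%O.
Proof. by split=> /meet_idPl. Qed.

Lemma meet_ltP (x y : L) : Order.meet x y = x /\ x <> y <-> (x < y)%O.
Proof.
rewrite lt_neqAle; split=> [[/meet_leP-> /eqP->] //|/andP[/eqP ? ?]].
by split=> //; apply/meet_leP.
Qed.

Lemma holds_bottom e i : holds e (bottom_formula i) <-> bottom (e i).
Proof. by split=> H y; apply/meet_leP/(H y). Qed.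

Lemma holds_coatomless e i : holds e (coatomless_formula i) <-> coatomless (e i).
Proof.
split=> H y.
  by move=> /meet_ltP/H[z [/meet_ltP yz /meet_ltP zx]]; exists z.
by move=> /meet_ltP/H[z [yz zx]]; exists z; split; exact/meet_ltP.
Qed.

Lemma holds_null_limit e i : holds e (null_limit_formula i) <-> null_limit (e i).
Proof.
split=> [[/holds_coatomless cx [a [[/meet_leP ax na] [da am]]]]|].
  split=> //; exists a; split=> // [ba|y /meet_leP yx ny]; first by apply/na/holds_bottom.
  by apply/meet_leP/(am y yx) => by_; apply/ny/(holds_bottom (env_cons y (env_cons a e)) 0).
move=> [cx [a [/meet_leP ax na da am]]]; split; first exact/holds_coatomless.
exists a; split; first by split=> // /(holds_bottom (env_cons a e) 0).
split=> // y /meet_leP yx ny; apply/meet_leP; apply: am => // by_.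
by apply/ny/holds_bottom.
Qed.

Lemma holds_chain e k : holds e (chain_formula k) <-> has_chain k (e 0).
Proof.
elim: k e => //= k IHk e; split=> -[y [yx cy]]; exists y.
  by split; [apply/meet_ltP; exact: yx|exact: ((IHk (env_cons y e)).1 cy)].
by split; [exact: ((meet_ltP _ _).2 yx)|exact: ((IHk (env_cons y e)).2 cy)].
Qed.

End LatticeProperties.

Lemma bottomP (W : variety) : bottom W <-> W = linear_variety 1.
Proof.
split=> [WV|-> V]; last exact: linear_variety1_le.
by apply/le_anti; rewrite WV linear_variety1_le.
Qed.

Lemma linear_variety_strict k : 0 < k -> (linear_variety k < linear_variety k.+1)%O.
Proof.
move=> k0; rewrite lt_leAnge linear_variety_mono //=; apply/negP.
by apply: linear_not_le k0 _ (@leq_up k.+1); rewrite ltnn.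
Qed.

Lemma linear_variety_lt_limit k : 0 < k -> (linear_variety k < linear_limit)%O.
Proof.
move=> k0; rewrite lt_leAnge linear_variety_le_limit /=; apply/negP.
exact: linear_not_le k0 _ pred0_up.
Qed.

Lemma null_limit_linear_limit : null_limit linear_limit.
Proof.
split=> [W WF|].
  have [|k Wk] := linear_limit_cover (ltW WF); first by apply/negP; rewrite lt_geF.
  exists (linear_variety k.+2); split; last exact: linear_variety_lt_limit.
  exact: le_lt_trans Wk (linear_variety_strict _).
exists (linear_variety 2); split; first exact: linear_variety_le_limit.
- by move/bottomP=> e; have := linear_variety_strict (isT : 0 < 1); rewrite e ltxx.
- exact: null_distributive.
move=> W WF nW; apply: contrapT => /(linear_variety_cover WF) W1; apply: nW; apply/bottomP.
by apply/le_anti; rewrite W1 linear_variety1_le.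
Qed.

(** The subvarieties F_1 < ... < F_(k+1) form a chain with k steps, and since each
    F_j is the largest subvariety not containing F_(j+1), there are no longer
    ones. *)
Lemma has_chainP (W : variety) k : (W <= linear_limit)%O ->
  has_chain k W <-> (linear_variety k.+1 <= W)%O.
Proof.
elim: k W => [|k IHk] W WF; first by split=> // _; exact: linear_variety1_le.
split=> [[V [VW /IHk Vk]]|Wk].
  apply: contrapT => /(linear_variety_cover WF) Wk.
  have := lt_le_trans VW Wk; rewrite lt_leAnge => /andP[_ /negP]; apply.
  by apply: Vk; apply: le_trans (ltW VW) WF.
exists (linear_variety k.+1); split; first exact: lt_le_trans (linear_variety_strict _) Wk.
by apply/IHk => //; exact: linear_variety_le_limit.
Qed.

(** Without null semigroups x = x^(m+1) holds with 0 < m, hence so does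
    x = x^(km+1) for all k; for km large the powers are stationary by aperiodicity,
    so that x = x^2.  The bands in V are commutative by [band_commutative]. *)
Lemma le_semilattice (V : variety) :
  ~ (linear_variety 2 <= V)%O -> ~ (generated left_zero_band <= V)%O ->
  ~ (generated right_zero_band <= V)%O ->
  (forall p, 0 < p -> ~ (generated (cyclic_group p) <= V)%O) ->
  (V <= generated semilattice)%O.
Proof.
move=> nZ nL nR nC; have [//|[i [w [Vw w2]]]] := null_le_or_letter V.
have [n Vn] := aperiodic nC; pose m := size w.2.
have V0m : power_identity V 0 (0 + m).
  by move=> S VS x; have := Vw S VS (fun=> x); rewrite /= !word_val_const.
have band S : variety_class V S -> forall x : S, x ** x = x.
  move=> VS x; have nm : n <= n * m by rewrite leq_pmulr // /m; case: (w.2) w2.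
  have := power_identityM n V0m VS x; rewrite add0n => x0.
  rewrite -[x ** x]/(power x 1) -[in RHS](_ : power x 0 = x) // x0.
  have -> : power x 1 = power x (n * m).+1.
    by rewrite !powerS x0.
  rewrite -(subnK nm) addnC.
  by have := power_identityD (n * m - n) Vn VS x; rewrite addSn => ->.
apply/le_defined_by => -[u v] uv S VS; apply: semilattice_identity; last exact: uv.
  exact: band.
exact: (band_commutative nL nR VS (band S VS)).
Qed.

(** Semilattices form an atom: if W does not contain them all, then the
    semilattices in W satisfy x = xy, hence x = y. *)
Lemma semilattice_le (W : variety) : (W <= generated semilattice)%O ->
  W <> linear_variety 1 -> (generated semilattice <= W)%O.
Proof.
move=> WS W1; apply: contrapT => nS; apply: W1; apply: trivial_variety => S x y WSS.
have sat u v : satisfies semilattice (u, v) -> satisfies S (u, v).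
  by move=> /(le_generated WS); apply.
have band (z : S) : z ** z = z.
  by apply: (sat (0, [:: 0]) (0, [::]) _ (fun=> z)) => f; apply: andbb.
have comm (a b : S) : a ** b = b ** a.
  apply: (sat (0, [:: 1]) (1, [:: 0]) _ (fun i => if i is 0 then a else b)) => f.
  exact: andbC.
have absorb (a b : S) : a = a ** b.
  apply: (semilattice_pair nS WSS); rewrite ?band //.
    by rewrite sg_mulA band.
  by rewrite comm sg_mulA band.
by rewrite (absorb x y) comm -absorb.
Qed.

Lemma generated_nontrivial (S : semigroup) (x y : S) : x <> y ->
  generated S <> linear_variety 1.
Proof.
move=> xy S1; apply: xy.
have : variety_class (linear_variety 1) S by rewrite -S1 => u; apply.
have E : linear_theory (leq 1) ((0, [::]), (1, [::])) by right.
by move=> /(_ _ E (fun i => if i is 0 then x else y)).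
Qed.

(** The least nontrivial subvariety a of U lies in every nontrivial variety below
    U.  This excludes left and right zero bands and groups, where a would not be
    distributive, and semilattices, as these form an atom.  So U is nil, and not
    nilpotent since it has no coatom. *)
Lemma linear_limit_le (U : variety) : null_limit U -> (linear_limit <= U)%O.
Proof.
move=> [cU [a [aU /bottomP a1 da am]]].
have a_le W : W <> linear_variety 1 -> (W <= U)%O -> (a <= W)%O.
  by move=> W1 WU; apply: am => // /bottomP.
have tf : true <> false by [].
have gen (S : semigroup) (x y : S) : x <> y ->
    (generated S <= U)%O -> (a <= generated S)%O.
  by move=> xy; apply/a_le/(generated_nontrivial xy).
have nL : ~ (generated left_zero_band <= U)%O.
  move=> /(gen left_zero_band true false tf) aL.
  exact: (left_zero_not_distributive aL a1 da).
have nR : ~ (generated right_zero_band <= U)%O.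
  move=> /(gen right_zero_band true false tf) aR.
  exact: (right_zero_not_distributive aR a1 da).
have nC p : 0 < p -> ~ (generated (cyclic_group p) <= U)%O.
  move=> p0 CU; apply: (cyclic_not_distributive p0 _ a1 da).
  have p1 : 1 < p.+1 by [].
  apply: (gen (cyclic_group p) (exist _ 0 (ltn0Sn p)) (exist _ 1 p1)) CU.
  by move/(congr1 val).
have nS : ~ (generated semilattice <= U)%O.
  move=> SU; have aS := gen semilattice true false tf SU.
  have nZ : ~ (linear_variety 2 <= U)%O.
    move=> ZU; have aZ : (a <= linear_variety 2)%O.
      by apply: a_le ZU => Z1; have := linear_variety_strict (isT : 0 < 1); rewrite Z1 ltxx.
    apply: a1; apply: trivial_variety => S x y aSS.
    have band (z : S) : z = z ** z.
      have /(_ _ aSS (fun=> z)) : theory a ((0, [::]), (0, [:: 0])); last exact.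
      by apply: (le_generated aS) => f; symmetry; apply: andbb.
    rewrite (band x) (band y).
    have /(_ _ aSS (fun i => if i is 0 then x else y)) :
      theory a ((0, [:: 0]), (1, [:: 1])); last exact.
    by move/le_theory: aZ; apply; apply/theory_null; right.
  have US := le_semilattice nZ nL nR nC.
  have U1 : (linear_variety 1 < U)%O.
    rewrite lt_neqAle linear_variety1_le andbT; apply/eqP => U1; apply: a1.
    by apply/le_anti; rewrite {1}U1 aU linear_variety1_le.
  have [W []] := cU _ U1; rewrite lt_neqAle => /andP[/eqP W1 _] WU.
  have := lt_le_trans WU US; rewrite lt_leAnge => /andP[WS /negP]; apply.
  by apply: semilattice_le WS _ => e; apply: W1.
have [n Un] := aperiodic nC.
have nil := nil_of_no_small_varieties nL nR nS Un.
apply: contrapT => /(not_linear_le pred0_up)[k [_ Uk]].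
apply: a1; apply: le_anti; rewrite linear_variety1_le andbT.
suff <- : U = linear_variety 1 by [].
apply: (nilpotent_coatomless (k := k.+1)) cU => w w' kw kw' S US f /=.
have [z [zP zn]] := nil S US.
have Sk : semigroup_power S k.+1 = [set z].
  by apply: Uk => //; split=> // x; exists n.
have zero v : k < size (letters v) -> word_val f v = z.
  move=> kv; suff : semigroup_power S k.+1 (word_val f v) by rewrite Sk.
  exact: (@semigroup_power_sub S k (size v.2) kv) (word_val_power f v).
by rewrite !zero.
Qed.

Theorem theorem3p1 :
  definable [set V : variety | finite_degree V] /\
  forall k : nat, 0 < k -> definable [set V : variety | has_degree V k].
Proof.
split=> [|[//|k] _].
  exists (Forall (Defs.Implies (null_limit_formula 0)
                    (Not (le_formula (Var 0) (Var 1))))) => // V.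
  split=> [H|/finite_degreeP nV U /holds_null_limit/linear_limit_le FU /meet_leP UV].
    apply/finite_degreeP => FV; have := H linear_limit; apply; last exact/meet_leP.
    by apply/holds_null_limit; exact: null_limit_linear_limit.
  by apply: nV; apply: le_trans UV.
(* The formula names the least x with [null_limit x], then its meet with V; the
   number of steps is k because the degree is k+1. *)
exists (Exists (And (And (null_limit_formula 0)
    (Forall (Defs.Implies (null_limit_formula 0) (le_formula (Var 1) (Var 0)))))
  (Exists (And (Eq (Var 0) (Meet (Var 2) (Var 1)))
    (And (chain_formula k) (Not (chain_formula k.+1))))))).
  by rewrite /= !chain_formula_closed.
have chainP V j :
    has_chain j (Order.meet V linear_limit) <-> (linear_variety j.+1 <= V)%O.
  by rewrite has_chainP ?leIr // lexI linear_variety_le_limit andbT.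
move=> V; pose e F W := env_cons W (env_cons F (fun=> V)).
split=> [[F [[/holds_null_limit NF minF] [W [WE [cW nW]]]]]|].
  have FE : F = linear_limit.
    apply/le_anti; rewrite (linear_limit_le NF) andbT; apply/meet_leP/minF.
    by apply/holds_null_limit; exact: null_limit_linear_limit.
  have {}WE : W = Order.meet V linear_limit by rewrite -FE.
  apply/has_degreeP => //; split.
    by apply/chainP; rewrite -WE; exact: ((holds_chain (e F W) k).1 cW).
  by move=> /chainP; rewrite -WE => c; exact: (nW ((holds_chain (e F W) k.+1).2 c)).
move=> /has_degreeP[//|/chainP cV nV]; exists linear_limit; split.
  split; first by apply/holds_null_limit; exact: null_limit_linear_limit.
  by move=> U /holds_null_limit/linear_limit_le/meet_leP.
exists (Order.meet V linear_limit); split=> //; split.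
  exact: ((holds_chain (e linear_limit _) k).2 cV).
by move=> /(holds_chain (e linear_limit (Order.meet V linear_limit)) k.+1)/chainP.
Qed.
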